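(* Let $\epsilon>0$ be a constant. Consider the following static problem on an unweighted undirected path $G=(V,E)$ with $n$ vertices and a coloring $c:V\to C$, where $\sigma=|C|\le O(n^{1-\epsilon})$. Given $v\in V$ and $c\in C$, report an estimate $\widehat{\mathbf{dist}}(v,c)$ with $\mathbf{dist}(v,c)\le\widehat{\mathbf{dist}}(v,c)\le k\,\mathbf{dist}(v,c)$, where the approximation factor is $k=O(\mathrm{polylog}(n))$. Any data structure for this problem in the cell-probe model with word size $w=\Theta(\log n)$ that uses space $S$ has query time $$\Omega\left(\log\frac{\log\sigma}{\log\frac{S}{n}+\log\log n}\right).$$ This holds for deterministic queries and for randomized queries with constant error probability.
   Context: $\mathbf{dist}(v,c)=\min\{\mathbf{dist}(v,u):u\in V,\ c(u)=c\}$, the distance from $v$ to a nearest vertex of color $c$. In the cell-probe model, the data structure is stored in $S$ cells of $w$ bits each, and query time counts only the number of cells read.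
   Formalization: For S < n the term log(S/n) is read as 0 (fewer than n cells count as n cells); as printed the bound fails there, e.g. σ = 2, w = C log n, S just above n/log n, where O(1) probes suffice although the formula gives order log n. *)

(* Defs.v *)
From HB Require Import structures.
From mathcomp Require Import all_boot all_order all_algebra.
From mathcomp Require Import all_classical all_reals all_analysis.

Set Implicit Arguments.
Unset Strict Implicit.
Unset Printing Implicit Defensive.

Import Order.TTheory GRing.Theory Num.Theory.
Local Open Scope classical_set_scope.
Local Open Scope ring_scope.

Section GraphDistance.
Variables (V : finType) (e : rel V).

Definition has_walk (l : nat) (x y : V) : bool :=
  [exists p : l.-tuple V, path e x p && (last x p == y)].

(* Length of a shortest walk.  A shortest walk has fewer than #|V| edges, so the
   search is exhaustive; disconnected pairs get #|V|. *)
Definition gdist (x y : V) : nat :=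
  find (fun l => has_walk l x y) (iota 0 #|V|).

Variables (C : eqType) (col : V -> C).

(* The minimum over the vertices of colour c; meaningful only if c occurs. *)
Definition cdist (v : V) (c : C) : nat :=
  \big[minn/#|V|]_(u | col u == c) gdist v u.

End GraphDistance.

Definition path_graph (n : nat) : rel 'I_n :=
  fun i j => (i.+1 == j :> nat) || (j.+1 == i :> nat).

Section CellProbe.

Definition memory (S w : nat) := 'I_S -> w.-tuple bool.

(* A deterministic query algorithm: an adaptive decision tree.  Computation
   between two probes is free, hence the arbitrary branching function. *)
Inductive probe_tree (S w : nat) (A : Type) : Type :=
| Answer of A
| Probe of 'I_S & (w.-tuple bool -> probe_tree S w A).

Fixpoint run S w A (m : memory S w) (t : probe_tree S w A) : A :=
  match t with
  | Answer a => a
  | Probe i k => run m (k (m i))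
  end.

Fixpoint nprobes S w A (m : memory S w) (t : probe_tree S w A) : nat :=
  match t with
  | Answer _ => 0%N
  | Probe i k => (nprobes m (k (m i))).+1
  end.

(* A static problem: inputs I, queries Q, answers A, and the relation
   ok i q a, "a is an acceptable answer to query q on input i". *)
Variables (I Q A : Type) (ok : I -> Q -> A -> Prop).

Record det_ds (S w : nat) := DetDS {
  det_prep : I -> memory S w;
  det_query : Q -> probe_tree S w A }.

Definition det_solves S w (D : det_ds S w) :=
  forall i q, ok i q (run (det_prep D i) (det_query D q)).

Definition det_time_le S w (D : det_ds S w) (T : nat) :=
  forall i q, (nprobes (det_prep D i) (det_query D q) <= T)%N.

(* The memory depends on the input only; the query algorithm also depends on
   an outcome of the probability space Omega. *)
Record rand_ds (Omega : Type) (S w : nat) := RandDS {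
  rand_prep : I -> memory S w;
  rand_query : Omega -> Q -> probe_tree S w A }.

Definition rand_solves (R : realType) (d : measure_display)
    (Omega : measurableType d) (P : probability Omega R) (delta : R)
    S w (D : rand_ds Omega S w) :=
  forall i q,
    let correct :=
      [set om | ok i q (run (rand_prep D i) (rand_query D om q))] in
    measurable correct /\ ((1 - delta)%:E <= P correct)%E.

Definition rand_time_le (Omega : Type) S w (D : rand_ds Omega S w) (T : nat) :=
  forall om i q, (nprobes (rand_prep D i) (rand_query D om q) <= T)%N.

End CellProbe.

(* Queries about a colour that does not occur have no distance to approximate
   and are left unconstrained. *)
Definition approx_ok (R : realType) (n sigma : nat) (k : R)
    (col : {ffun 'I_n -> 'I_sigma}) (q : 'I_n * 'I_sigma) (est : R) : Prop :=
  (exists u, col u = q.2) ->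
  let dist := (cdist (@path_graph n) col q.1 q.2)%:R in
  dist <= est <= k * dist.

(* The instances (n, sigma, k, w) compatible with fixed constants in
   sigma <= O(n^(1 - eps)), k = O(polylog n) and w = Theta(log n).  Logarithms
   are natural; changing their base only affects the constants. *)
Definition regime (R : realType) (eps M a : R) (b : nat) (wl wu : R)
    (n sigma : nat) (k : R) (w : nat) : Prop :=
  [/\ sigma%:R <= M * n%:R `^ (1 - eps),
      k <= a * ln n%:R ^+ b
    & wl * ln n%:R <= w%:R <= wu * ln n%:R].

(* log (log sigma / (log (S / n) + log log n)), where a memory of fewer than n
   cells counts as n cells, i.e. log (S / n) is read as 0 when S < n.  This
   convention is needed: for sigma = 2 a rank/select bit vector answers queries
   exactly in O(1) probes with S = O(n / log n) cells, and S can then be chosen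
   so that log (S / n) + log log n is positive but arbitrarily close to 0. *)
Definition probe_bound (R : realType) (n sigma S : nat) : R :=
  ln (ln sigma%:R / (ln ((maxn S n)%:R / n%:R) + ln (ln n%:R))).

(* Main.v *)
(** The proof is a round elimination in the style of Patrascu and Thorup.

    A hard instance consists of independent roots, one for every active colour and every
    block of the path.  At each level of a root the query string is cut into two halves and
    a coin is tossed: either all data share one hidden first half and the search continues
    in the second half, or the search continues in the first half and the second half is
    noise.  Distances at different levels differ by more than the approximation factor, so
    an estimate reveals the whole sequence of coins.

    Given the first half of a query, call a cell popular if it is the first probe of at
    least a fraction [1 / theta] of the second halves.  If the first half is shared, then
    publishing its at most [theta] popular cells saves a probe for the queries whose first
    probe is popular.  If the second half is noise, it can be resampled so that an unpopular
    first probe falls into a small random set of published cells.  Every query thus saves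
    its first probe under at least one of the two outcomes of the coin, and the expectation
    of [2^-probes] on correct answers drops by the factor [(1 + 1/2) / 2 = 3/4] per level.

    The coins stay almost independent of the published bits as long as there are many more
    roots than published bits.  Each level multiplies the number of roots by a bit more
    than the square root of the number of cells per root, which allows
    [log (log sigma / (log (S / n) + log log n))] levels, up to constants. *)

Require Import Defs.
From HB Require Import structures.
From mathcomp Require Import all_boot all_order all_algebra.
From mathcomp Require Import all_classical all_reals all_analysis.
From mathcomp Require Import measurable_realfun ring lra zify.
Import Order.TTheory GRing.Theory Num.Theory.
Local Open Scope ring_scope.

Set Implicit Arguments.
Unset Strict Implicit.
Unset Printing Implicit Defensive.

(** * Uniform averages *)

Lemma sum_pairE (R : realType) (T U : finType) (F : T * U -> R) :
  \sum_p F p = \sum_x \sum_y F (x, y).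
Proof. by rewrite pair_bigA; apply: eq_bigr => -[]. Qed.

Lemma prod_pairE (R : realType) (T U : finType) (F : T * U -> R) :
  \prod_p F p = \prod_x \prod_y F (x, y).
Proof. by rewrite pair_bigA; apply: eq_bigr => -[]. Qed.

Lemma big_unit (R : realType) (F : unit -> R) : \sum_x F x = F tt.
Proof. by rewrite (bigD1 tt)//= big1 ?addr0// => -[]. Qed.

Section Average.
Variable R : realType.

Definition avg (T : finType) (f : T -> R) : R := #|T|%:R^-1 * \sum_x f x.

Lemma avg0 (T : finType) : avg (fun _ : T => 0) = 0.
Proof. by rewrite /avg big1 ?mulr0. Qed.

Lemma eq_avg (T : finType) (f h : T -> R) : f =1 h -> avg f = avg h.
Proof. by move=> fh; rewrite /avg (eq_bigr h). Qed.

Lemma avg_const (T : finType) (a : R) : (0 < #|T|)%N -> avg (fun _ : T => a) = a.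
Proof.
move=> T0; rewrite /avg sumr_const -[a *+ _]mulr_natl mulrA mulVf ?mul1r //.
by rewrite pnatr_eq0 -lt0n.
Qed.

Lemma ler_avg (T : finType) (f h : T -> R) : (forall x, f x <= h x) -> avg f <= avg h.
Proof. by move=> fh; rewrite /avg ler_wpM2l ?invr_ge0 ?ler0n// ler_sum. Qed.

Lemma avg_ge0 (T : finType) (f : T -> R) : (forall x, 0 <= f x) -> 0 <= avg f.
Proof. by move=> f0; rewrite -(avg0 T); apply: ler_avg. Qed.

Lemma avg_le (T : finType) (f : T -> R) a : 0 <= a -> (forall x, f x <= a) -> avg f <= a.
Proof.
move=> a0 fa; have [T0|T0] := posnP #|T|; last by rewrite -(avg_const a T0); apply: ler_avg.
by rewrite /avg T0 invr0 mul0r.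
Qed.

Lemma avgD (T : finType) (f h : T -> R) : avg (fun x => f x + h x) = avg f + avg h.
Proof. by rewrite /avg big_split mulrDr. Qed.

Lemma avgZl (T : finType) a (f : T -> R) : avg (fun x => a * f x) = a * avg f.
Proof. by rewrite /avg -mulr_sumr mulrCA. Qed.

Lemma avgZr (T : finType) a (f : T -> R) : avg (fun x => f x * a) = avg f * a.
Proof. by rewrite mulrC -avgZl; apply: eq_avg => x; rewrite mulrC. Qed.

Lemma avg_sum (T J : finType) (f : J -> T -> R) :
  avg (fun x => \sum_j f j x) = \sum_j avg (f j).
Proof. by rewrite /avg exchange_big mulr_sumr. Qed.

Lemma exchange_avg (T U : finType) (f : T -> U -> R) :
  avg (fun x => avg (f x)) = avg (fun y => avg (f^~ y)).
Proof. by rewrite {1}/avg -avg_sum -avgZl; apply: eq_avg. Qed.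

Lemma avg_pair (T U : finType) (f : T * U -> R) :
  avg f = avg (fun x => avg (fun y => f (x, y))).
Proof.
rewrite /avg card_prod natrM invfM -mulr_sumr mulrA; congr (_ * _).
by rewrite pair_bigA; apply: eq_bigr => -[].
Qed.

Lemma avg_bij (T U : finType) (h : T -> U) (f : U -> R) :
  bijective h -> avg f = avg (fun x => f (h x)).
Proof.
move=> bh; rewrite /avg (bij_eq_card bh); congr (_ * _).
by rewrite (reindex h) //; apply: onW_bij.
Qed.

Lemma avg_bool (f : bool -> R) : avg f = (f true + f false) / 2.
Proof. by rewrite /avg card_bool big_bool mulrC. Qed.

Lemma avg_ffun_prod (I T : finType) (f : I -> T -> R) :
  avg (fun D : {ffun I -> T} => \prod_i f i (D i)) = \prod_i avg (f i).
Proof.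
rewrite /avg big_split /= prodr_const exprVn card_ffun natrX.
by rewrite bigA_distr_bigA.
Qed.

Lemma avg_ffun_proj (I T : finType) (i : I) (f : T -> R) :
  avg (fun D : {ffun I -> T} => f (D i)) = avg f.
Proof.
have [T0|T0] := posnP #|T|.
  rewrite /avg !big1 ?mulr0// => [x|D] _; first by move: (card0_eq T0 x).
  by move: (card0_eq T0 (D i)).
transitivity (avg (fun D : {ffun I -> T} => \prod_j (if j == i then f else fun=> 1) (D j))).
  apply: eq_avg => D; rewrite (bigD1 i)//= eqxx big1 ?mulr1// => j /negbTE ->//.
rewrite (avg_ffun_prod (fun j => if j == i then f else fun=> 1)).
rewrite (bigD1 i)//= eqxx big1 ?mulr1// => j /negbTE ->; exact: avg_const.
Qed.

Lemma avg_ffun_proj2 (I T : finType) (i j : I) (f h : T -> R) : i != j ->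
  avg (fun D : {ffun I -> T} => f (D i) * h (D j)) = avg f * avg h.
Proof.
move=> ij; have [T0|T0] := posnP #|T|.
  rewrite /avg !big1 ?mulr0// => [x|x|D] _; try by move: (card0_eq T0 x).
  by move: (card0_eq T0 (D i)).
pose F k := if k == i then f else if k == j then h else fun=> 1.
transitivity (avg (fun D : {ffun I -> T} => \prod_k F k (D k))).
  apply: eq_avg => D; rewrite (bigD1 i)//= (bigD1 j) 1?eq_sym//= /F !eqxx.
  rewrite eq_sym (negbTE ij) big1 ?mulr1// => k /andP[/negbTE -> /negbTE ->]//.
rewrite avg_ffun_prod (bigD1 i)//= (bigD1 j) 1?eq_sym//= /F !eqxx eq_sym (negbTE ij).
rewrite big1 ?mulr1// => k /andP[/negbTE -> /negbTE ->]; exact: avg_const.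
Qed.

Lemma avg_ffun_var (I T : finType) (f : T -> R) : avg f = 0 ->
  avg (fun D : {ffun I -> T} => (\sum_i f (D i)) ^+ 2) = #|I|%:R * avg (fun x => f x ^+ 2).
Proof.
move=> f0.
transitivity (avg (fun D : {ffun I -> T} => \sum_i \sum_j f (D i) * f (D j))).
  apply: eq_avg => D; rewrite expr2 mulr_suml; apply: eq_bigr => i _.
  by rewrite mulr_sumr.
rewrite avg_sum -[#|I|]card_ord.
transitivity (\sum_(i : I) avg (fun x => f x ^+ 2)); last first.
  by rewrite sumr_const card_ord mulr_natl.
apply: eq_bigr => i _; rewrite avg_sum (bigD1 i)//= big1 ?addr0.
  exact: (avg_ffun_proj i (fun x => f x ^+ 2)).
by move=> j ji; rewrite avg_ffun_proj2 1?eq_sym// f0 mul0r.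
Qed.

(** Multiplied by [1 - x], the right side becomes [1 + x ^+ 2 * (1 - 2 * x) >= 1], while the left
    side is at most 1 because [expR (- x) >= 1 - x]. *)
Lemma expR_le_quad (x : R) : x <= 2^-1 -> expR x <= 1 + x + 2 * x ^+ 2.
Proof.
move=> x2; have e0 : expR x * (1 - x) <= 1.
  have := expR_ge1Dx (- x); rewrite expRN => h.
  by rewrite mulrC -ler_pdivlMr ?expR_gt0// div1r.
have x1 : 0 < 1 - x by lra.
rewrite -(ler_pM2r x1); apply: (le_trans e0).
have : 0 <= x ^+ 2 * (1 - 2 * x) by rewrite mulr_ge0 ?sqr_ge0//; lra.
by move=> h; rewrite [leRHS](_ : _ = 1 + x ^+ 2 * (1 - 2 * x)); [lra|ring].
Qed.

(* The mean of [exp (eta * Z)] is at most [#|B| * exp (2 eta^2 #|I|)] by a union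
   bound over the values of [pub]; the bound on the mean of [Z] follows by
   comparing [exp] with its tangent. *)
Lemma avg_union_bound (I T B : finType) (pub : {ffun I -> T} -> B)
    (F : B -> I -> T -> R) (eta : R) :
  0 < eta -> eta <= 2^-1 ->
  (forall b i x, 0 <= F b i x <= 1) ->
  avg (fun s => \sum_i F (pub s) i (s i)) <=
  avg (fun s => \sum_i avg (F (pub s) i)) + (ln #|B|%:R / eta + 2 * eta * #|I|%:R).
Proof.
move=> eta0 eta1 F01.
have [T0|T0] := posnP #|{ffun I -> T}|.
  have h f : avg (T := {ffun I -> T}) f = 0 by rewrite /avg T0 invr0 mul0r.
  rewrite !h add0r addr_ge0 ?mulr_ge0 ?invr_ge0 ?ler0n ?(ltW eta0)//.
  have [->|B0] := posnP #|B|; first by rewrite ln0.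
  by rewrite ln_ge0// ler1n.
have [s0 _] : exists s : {ffun I -> T}, true by case/card_gt0P: T0 => s _; exists s.
have B0 : (0 < #|B|)%N by apply/card_gt0P; exists (pub s0).
pose X b i x := F b i x - avg (F b i).
have X1 b i x : X b i x <= 1.
  have := F01 b i x => /andP[_ h]; rewrite /X.
  have : 0 <= avg (F b i) by apply: avg_ge0 => y; case/andP: (F01 b i y).
  lra.
have Xm1 b i x : -1 <= X b i x.
  have := F01 b i x => /andP[h _]; rewrite /X.
  have : avg (F b i) <= 1 by apply: avg_le => // y; case/andP: (F01 b i y).
  lra.
pose Z b (s : {ffun I -> T}) := \sum_i X b i (s i).
have expZ b : avg (fun s => expR (eta * Z b s)) <= expR (2 * eta ^+ 2 * #|I|%:R).
  have -> : avg (fun s => expR (eta * Z b s)) =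
            avg (fun s : {ffun I -> T} => \prod_i expR (eta * X b i (s i))).
    by apply: eq_avg => s; rewrite /Z mulr_sumr expR_sum.
  rewrite (avg_ffun_prod (fun i x => expR (eta * X b i x))).
  rewrite expRM_natr -prodr_const.
  apply: ler_prod => i _; apply/andP; split.
    by apply: avg_ge0 => x; apply: expR_ge0.
  have [T1|T1] := posnP #|T|.
    by rewrite /avg T1 invr0 mul0r expR_ge0.
  apply: (@le_trans _ _ (avg (fun x => 1 + eta * X b i x + 2 * eta ^+ 2))).
    apply: ler_avg => x; apply: (le_trans (expR_le_quad _)).
      have := X1 b i x; nra.
    rewrite lerD2l// ler_wpM2l// exprMn ler_piMr ?sqr_ge0//.
    have := X1 b i x; have := Xm1 b i x; nra.
  rewrite avgD avgD !avg_const// avgZl /X.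
  rewrite (avgD _ (fun=> - avg (F b i))) avg_const// subrr mulr0 addr0.
  exact: expR_ge1Dx.
(* [expR c] bounds the sum over all [b] of the exponential moments. With the tangent taken at [c]
   this factor cancels, and [eta * Z] has mean at most [c]. *)
pose c := ln #|B|%:R + 2 * eta ^+ 2 * #|I|%:R.
have lin : avg (fun s => expR c * (1 + eta * Z (pub s) s - c)) <= expR c.
  apply: (@le_trans _ _ (avg (fun s => \sum_b expR (eta * Z b s)))).
    apply: ler_avg => s; apply: (@le_trans _ _ (expR (eta * Z (pub s) s))).
      have := expR_ge1Dx (eta * Z (pub s) s - c); rewrite expRB => h.
      rewrite mulrC -ler_pdivlMr ?expR_gt0//; apply: le_trans h; lra.
    rewrite (bigD1 (pub s))//= lerDl sumr_ge0// => b _; exact: expR_ge0.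
  rewrite avg_sum; apply: (@le_trans _ _ (\sum_(b : B) expR (2 * eta ^+ 2 * #|I|%:R))).
    by apply: ler_sum => b _; apply: expZ.
  rewrite sumr_const /c expRD lnK ?posrE ?ltr0n// [leRHS]mulr_natl; exact: lexx.
move: lin; rewrite avgZl -[leRHS]mulr1 ler_pM2l ?expR_gt0//.
rewrite avgD avgD !avg_const// avgZl => lin.
have {}lin : avg (fun s => Z (pub s) s) <= c / eta by rewrite ler_pdivlMr//; lra.
have -> : ln #|B|%:R / eta + 2 * eta * #|I|%:R = c / eta.
  by rewrite /c; field; rewrite gt_eqF.
rewrite -lerBlDl; apply: le_trans lin; rewrite -[X in _ - X]mul1r -mulNr -avgZl -avgD.
apply: ler_avg => s; rewrite /Z /X mulN1r -sumrB; exact: lexx.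
Qed.

End Average.

(** * The hierarchical hard problem *)

Section Trees.
Variables (R : realType) (S w : nat).
Local Notation word := (w.-tuple bool).

Fixpoint map_tree A A' (f : A -> A') (t : probe_tree S w A) : probe_tree S w A' :=
  match t with
  | Answer a => Answer S w (f a)
  | Probe i k => Probe i (fun v => map_tree f (k v))
  end.

Lemma run_map_tree A A' (f : A -> A') m t : run m (map_tree f t) = f (run m t).
Proof. by elim: t => //= i k ->. Qed.

Lemma nprobes_map_tree A A' (f : A -> A') m t : nprobes m (map_tree f t) = nprobes m t.
Proof. by elim: t => //= i k ->. Qed.

Definition first_probe A (t : probe_tree S w A) : option 'I_S :=
  if t is Probe i _ then Some i else None.

(** The contents [cont] are an argument, separate from any memory: after the step they belong to the
    published value, on which a tree may depend. *)
Definition skip_probe (J : finType) (cells : J -> 'I_S) (cont : J -> word) A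
    (t : probe_tree S w A) : probe_tree S w A :=
  match t with
  | Answer _ => t
  | Probe i k => if [pick j | cells j == i] is Some j then k (cont j) else t
  end.

Definition score (m : memory S w) (t : probe_tree S w (seq bool)) (p : seq bool) : R :=
  (run m t == p)%:R * 2^-1 ^+ nprobes m t.

Lemma score_ge0 m t p : 0 <= score m t p.
Proof. by rewrite mulr_ge0 ?ler0n// exprn_ge0// invr_ge0. Qed.

Lemma score_le1 m t p : score m t p <= 1.
Proof.
rewrite mulr_ile1 ?ler0n// ?exprn_ge0 ?invr_ge0// ?exprn_ile1 ?invr_ge0 ?invf_le1 ?ler1n//.
by case: eqP.
Qed.

(** The head of the answer is the coin of the current level. A tree that answers at once has fixed
    its guess already, so it gets credit for at most one coin value; this is what replaces the saved
    probe for such trees. *)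
Lemma score_behead m t x p :
  score m t (x :: p) <=
  (if t is Answer a then (ohead a == Some x)%:R else 1) * score m (map_tree behead t) p.
Proof.
rewrite /score run_map_tree nprobes_map_tree mulrA.
apply: ler_wpM2r; first by rewrite exprn_ge0// invr_ge0.
case: eqP => [e|_]; last by rewrite mulr_ge0 ?ler0n//; case: t => *; rewrite ?ler0n.
rewrite e /= eqxx mulr1; case: t e => [a /= ->|//] /=; by rewrite eqxx.
Qed.

Lemma score_behead_le m t x p : score m t (x :: p) <= score m (map_tree behead t) p.
Proof.
apply: le_trans (score_behead m t x p) _; rewrite ler_piMl ?score_ge0//.
by case: t => // a; case: eqP.
Qed.

(** A published first probe becomes free, which is worth a factor 2 in the score. *)
Lemma score_skip (J : finType) (cells : J -> 'I_S) m t p :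
  score m t p =
  (if first_probe t is Some i then if [exists j, cells j == i] then 2^-1 else 1 else 1)
  * score m (skip_probe cells (fun j => m (cells j)) t) p.
Proof.
case: t => [a|i k] /=; first by rewrite mul1r.
case: pickP => [j /eqP ji|nj].
  have -> : [exists j, cells j == i] by apply/existsP; exists j; rewrite ji.
  by rewrite /score /= ji exprS mulrCA.
have -> : [exists j, cells j == i] = false by apply/existsP => -[j]; rewrite nj.
by rewrite mul1r.
Qed.

End Trees.

(* [ker y x] is the probability of the query [x] for the data [y], [pth y x] the answer to
   be found; [qpos] and [elt] place the queries and the data on a line. *)
Record problem (R : realType) := Problem {
  qry : finType;
  inp : finType;
  ker : inp -> qry -> R;
  pth : inp -> qry -> seq bool;
  qpos : qry -> nat;
  elt : inp -> nat -> bool }.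

(* The copies of [P] indexed by [I] share one memory, and [pub] is the part of the data that
   is known without probes.  The factor [2^-nprobes] in [score] allows a probe to be
   eliminated for some of the queries only. *)
Definition bounded (R : realType) (S w : nat) (eta : R) (P : problem R) (alpha v e : R) :=
  forall (I B J : finType) (pub : {ffun I -> inp P} -> B)
    (mem : {ffun I -> inp P} -> memory S w) (c : B -> I -> qry P -> J -> R)
    (tr : B -> I -> qry P -> J -> probe_tree S w (seq bool)),
  S%:R <= alpha * #|I|%:R -> ln #|B|%:R <= eta ^+ 2 * #|I|%:R ->
  (forall b i x r, 0 <= c b i x r) -> (forall b i x, \sum_r c b i x r <= 1) ->
  avg (fun D : {ffun I -> inp P} => \sum_i \sum_x ker (D i) x * \sum_r c (pub D) i x r *
    score R (mem D) (tr (pub D) i x r) (pth (D i) x)) <=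
  v * avg (fun D : {ffun I -> inp P} => \sum_i avg (fun x => \sum_r c (pub D) i x r)) + e * #|I|%:R.

Definition step_qry R (g : nat) (P : problem R) : finType :=
  (('I_g * qry P) * ('I_g * qry P))%type.
Definition step_inp R (g : nat) (P : problem R) : finType :=
  ((bool * ('I_g * qry P)) * {ffun 'I_g -> inp P})%type.

(* Type [true]: data and query share the hidden first half, and the search continues in the
   second half.  Type [false]: it continues in the first half, and the second half of the
   query is noise. *)
Definition step_ker R g (P : problem R) (y : step_inp g P) (x : step_qry g P) : R :=
  if y.1.1 then (x.1 == y.1.2)%:R * (g%:R^-1 * ker (y.2 x.2.1) x.2.2)
  else g%:R^-1 * ker (y.2 x.1.1) x.1.2 * #|{: 'I_g * qry P}|%:R^-1.

Definition step_pth R g (P : problem R) (y : step_inp g P) (x : step_qry g P) :=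
  y.1.1 :: (if y.1.1 then pth (y.2 x.2.1) x.2.2 else pth (y.2 x.1.1) x.1.2).

Section StepPositions.
Variables (R : realType) (g U H : nat) (P : problem R).
Local Notation Z := ('I_g * qry P)%type.

(** The [g] copies of [P] lie side by side in intervals of length [2 * U] whose second halves stay
    empty. Elements of other copies are then farther away than [U], which exceeds every nearest
    distance that [sound] allows. *)
Definition cpos (u : Z) : nat := (u.1 * (2 * U) + qpos u.2)%N.
Definition cwidth : nat := (g * (2 * U))%N.
(** The first half of a query is the high-order digit in base [stride]. Through [H], a difference in
    this digit outweighs distances inside a low-order digit even after approximation. *)
Definition stride : nat := (H * cwidth)%N.

Definition sub_elt (f : {ffun 'I_g -> inp P}) (a : nat) : bool :=
  if insub (a %/ (2 * U))%N is Some k then elt (f k) (a %% (2 * U))%N else false.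

Definition step_qpos (x : step_qry g P) : nat := (cpos x.1 * stride + cpos x.2)%N.

(* For type [false] the otherwise useless [y.1.2] spreads the elements evenly over the line;
   [avg_bad] below needs this. *)
Definition step_elt (y : step_inp g P) (v : nat) : bool :=
  if y.1.1 then (v %/ stride == cpos y.1.2)%N && sub_elt y.2 (v %% stride)%N
  else (v %% stride == cpos y.1.2)%N && sub_elt y.2 (v %/ stride)%N.

Definition step : problem R :=
  Problem (@step_ker R g P) (@step_pth R g P) step_qpos step_elt.

End StepPositions.

Section Step.
Variables (R : realType) (g : nat) (P : problem R).
Hypotheses (g_gt0 : (0 < g)%N) (qry_gt0 : (0 < #|qry P|)%N).
Local Notation Z := ('I_g * qry P)%type.

Lemma card_Z_gt0 : (0 < #|{: Z}|)%N.
Proof. by rewrite card_prod card_ord muln_gt0 g_gt0. Qed.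

(** A common parametrisation of both types: [u] is the half in which the search continues and [z] is
    the noise. *)
Definition make_query (sg : bool * Z) (u z : Z) : step_qry g P :=
  if sg.1 then (sg.2, u) else (u, z).

Lemma sum_step_ker (y : step_inp g P) (Phi : step_qry g P -> R) :
  \sum_x step_ker y x * Phi x =
  \sum_(u : Z) g%:R^-1 * ker (y.2 u.1) u.2 * avg (fun z => Phi (make_query y.1 u z)).
Proof.
case: y => -[ty h] f; rewrite /step_ker /make_query /=; case: ty => /=.
- transitivity (\sum_(a : Z) \sum_(u : Z)
      (a == h)%:R * (g%:R^-1 * ker (f u.1) u.2) * Phi (a, u)).
    by rewrite pair_bigA; apply: eq_bigr => -[].
  rewrite (bigD1 h)//= [X in _ + X]big1 ?addr0; last first.
    by move=> a /negbTE ->; rewrite big1// => u _; rewrite !mul0r.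
  by apply: eq_bigr => u _; rewrite eqxx mul1r avg_const ?card_Z_gt0.
- transitivity (\sum_(u : Z) \sum_(z : Z)
      g%:R^-1 * ker (f u.1) u.2 * #|{: Z}|%:R^-1 * Phi (u, z)).
    by rewrite pair_bigA; apply: eq_bigr => -[].
  by apply: eq_bigr => u _; rewrite -mulr_sumr -mulrA.
Qed.

Definition join (I : finType) (s : {ffun I -> bool * Z}) (D : {ffun I * 'I_g -> inp P}) :
  {ffun I -> step_inp g P} := [ffun i => (s i, [ffun a => D (i, a)])].

(** Splits the data into independent coins, one per root, and [#|I| * g] independent copies of [P],
    the roots of the next level. *)
Lemma avg_join (I : finType) (Phi : {ffun I -> step_inp g P} -> R) :
  avg Phi = avg (fun s => avg (fun D => Phi (join s D))).
Proof.
pose J (sD : {ffun I -> bool * Z} * {ffun I * 'I_g -> inp P}) := join sD.1 sD.2.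
suff bJ : bijective J by rewrite (avg_bij _ bJ) avg_pair.
pose J' (D : {ffun I -> step_inp g P}) : {ffun I -> bool * Z} * {ffun I * 'I_g -> inp P} :=
  ([ffun i => (D i).1], [ffun ia : I * 'I_g => (D ia.1).2 ia.2]).
apply: (@Bijective _ _ J J').
  by case=> s D; congr pair; apply/ffunP; [move=> i|case=> i a]; rewrite !ffunE//= !ffunE.
move=> D; apply/ffunP => i; rewrite !ffunE; case E : (D i) => [a f] /=; congr pair.
by apply/ffunP => b; rewrite !ffunE /= E.
Qed.

End Step.

(** * Eliminating one probe *)

Section StepBody.
Variables (R : realType) (S w : nat) (eta : R) (g theta : nat) (P : problem R).
Hypotheses (S_gt0 : (0 < S)%N) (g_gt0 : (0 < g)%N) (theta_gt0 : (0 < theta)%N).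
Hypotheses (eta_gt0 : 0 < eta).
Hypothesis qry_gt0 : (0 < #|qry P|)%N.
Local Notation Z := ('I_g * qry P)%type.
Local Notation word := (w.-tuple bool).
Local Notation tree := (probe_tree S w (seq bool)).

Variables (I B J : finType) (c : B -> I -> step_qry g P -> J -> R).
Variable (tr : B -> I -> step_qry g P -> J -> tree).
Hypothesis c_ge0 : forall b i x r, 0 <= c b i x r.
Hypothesis c_le1 : forall b i x, \sum_r c b i x r <= 1.
Hypothesis S_le : S%:R <= eta ^+ 2 * (theta ^ 2 * #|I|)%:R.

Let Zn : R := #|{: Z}|%:R.
Let Z_gt0 : (0 < #|{: Z}|)%N := card_Z_gt0 g_gt0 qry_gt0.

Definition hit (cell : 'I_S) (t : tree) : R := (first_probe t == Some cell)%:R.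

Definition mass b i z1 (f : tree -> R) : R :=
  avg (fun z2 : Z => \sum_r c b i (z1, z2) r * f (tr b i (z1, z2) r)).

Definition rho b i z1 cell := mass b i z1 (hit cell).
(* For type [true] the popular cells of the shared first half are published; for type
   [false] an unpopular first probe is steered into the published random sample. *)
Definition popular b i z1 cell := theta%:R^-1 <= rho b i z1 cell.

Lemma mass_ge0 b i z1 f : (forall t, 0 <= f t) -> 0 <= mass b i z1 f.
Proof. by move=> f0; apply: avg_ge0 => z; apply: sumr_ge0 => r _; rewrite mulr_ge0. Qed.

Lemma mass_le1 b i z1 f : (forall t, f t <= 1) -> mass b i z1 f <= 1.
Proof.
move=> f1; apply: avg_le => // z; apply: le_trans (c_le1 b i (z1, z)).
by apply: ler_sum => r _; rewrite ler_piMr.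
Qed.

Lemma massD b i z1 f h : mass b i z1 (fun t => f t + h t) = mass b i z1 f + mass b i z1 h.
Proof.
by rewrite /mass -avgD; apply: eq_avg => z; rewrite -big_split; apply: eq_bigr => r _;
  rewrite mulrDr.
Qed.

Lemma massZ b i z1 a f : mass b i z1 (fun t => a * f t) = a * mass b i z1 f.
Proof.
by rewrite /mass -avgZl; apply: eq_avg => z; rewrite mulr_sumr; apply: eq_bigr => r _;
  rewrite mulrCA.
Qed.

Lemma mass_sum (T : finType) b i z1 (f : T -> tree -> R) :
  mass b i z1 (fun t => \sum_a f a t) = \sum_a mass b i z1 (f a).
Proof.
rewrite /mass -avg_sum; apply: eq_avg => z; rewrite exchange_big; apply: eq_bigr => r _.
by rewrite mulr_sumr.
Qed.

Lemma mass_avg (T : finType) b i z1 (f : T -> tree -> R) :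
  avg (fun a => mass b i z1 (f a)) = mass b i z1 (fun t => avg (f^~ t)).
Proof. by rewrite {1}/avg -mass_sum -massZ. Qed.

Lemma sum_hit_le1 (A : pred 'I_S) t : \sum_(a | A a) hit a t <= 1.
Proof.
rewrite /hit; case: (first_probe t) => [a|]; last by rewrite big1.
have [Aa|Aa] := boolP (A a).
  rewrite (bigD1 a)//= eqxx big1 ?addr0// => b /andP[_ ba].
  by rewrite -[_ == _]/(a == b) eq_sym (negbTE ba).
rewrite big1// => b Ab; rewrite -[_ == _]/(a == b); case: eqP => // ab.
by rewrite ab Ab in Aa.
Qed.

Lemma sum_rho_le1 b i z1 : \sum_a rho b i z1 a <= 1.
Proof. by rewrite -mass_sum; apply: mass_le1 => t; apply: sum_hit_le1. Qed.

Lemma rho_ge0 b i z1 a : 0 <= rho b i z1 a.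
Proof. by apply: mass_ge0 => t; rewrite ler0n. Qed.

(** Markov's inequality: the values [rho] of all cells add up to at most 1. *)
Lemma card_popular b i z1 : (#|[pred a | popular b i z1 a]| <= theta)%N.
Proof.
have : \sum_(a | popular b i z1 a) theta%:R^-1 <= (1 : R).
  apply: le_trans (sum_rho_le1 b i z1).
  apply: (@le_trans _ _ (\sum_(a | popular b i z1 a) rho b i z1 a)); first exact: ler_sum.
  by rewrite [leRHS](bigID (popular b i z1))/= lerDl sumr_ge0// => a _; apply: rho_ge0.
rewrite sumr_const -[X in X <= _]mulr_natl ler_pdivrMr ?ltr0n// mul1r ler_nat.
by move=> h; apply: leq_trans h; apply/subset_leq_card/fintype.subsetP => a; rewrite inE.
Qed.

(** Always [theta] entries, so that the published contents have a fixed type; the list is padded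
    with cell 0. *)
Definition popular_cells b i z1 : {ffun 'I_theta -> 'I_S} :=
  [ffun k : 'I_theta => nth (Ordinal S_gt0) (enum [pred a | popular b i z1 a]) k].

Lemma popular_cellsP b i z1 a : popular b i z1 a -> [exists k, popular_cells b i z1 k == a].
Proof.
move=> pa; have ain : a \in enum [pred a | popular b i z1 a] by rewrite mem_enum inE.
have lt : (index a (enum [pred a | popular b i z1 a]) < theta)%N.
  by apply: leq_trans (card_popular b i z1); rewrite cardE index_mem.
by apply/existsP; exists (Ordinal lt); rewrite ffunE /= nth_index.
Qed.

Let s := (theta * #|I|)%N.
Local Notation sample := {ffun 'I_s -> 'I_S}.

(** Importance weight: the number of times [a] was drawn, relative to its expectation [s / S]. *)
Definition sample_weight (Q : sample) (a : 'I_S) : R := S%:R / s%:R * \sum_j (Q j == a)%:R.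

Lemma sample_weight_ge0 Q a : 0 <= sample_weight Q a.
Proof. by rewrite mulr_ge0 ?mulr_ge0 ?invr_ge0// sumr_ge0. Qed.

Lemma avg_sample_weight (i : I) a : avg (sample_weight^~ a) = 1.
Proof.
have s0 : s%:R != 0 :> R.
  by rewrite pnatr_eq0 -lt0n muln_gt0 theta_gt0; apply/card_gt0P; exists i.
have S0 : S%:R != 0 :> R by rewrite pnatr_eq0 -lt0n.
rewrite /sample_weight avgZl avg_sum (eq_bigr (fun=> S%:R^-1)) => [|j _]; last first.
  rewrite (avg_ffun_proj j (fun x => (x == a)%:R)) /avg card_ord (bigD1 a)//= eqxx.
  by rewrite big1 ?addr0 ?mulr1// => x /negbTE ->.
rewrite sumr_const card_ord -[S%:R^-1 *+ _]mulr_natl mulrA mulfVK // divff//.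
Qed.

(* [sample_weight Q] has mean 1 over the samples [Q], so weighting by [mult] is neutral on
   average. *)
Definition mult (Q : sample) (ty : bool) b i z1 (t : tree) : R :=
  if first_probe t is Some a then
    if ty || popular b i z1 a then 1 else sample_weight Q a
  else 1.

(** What remains of the score relative to the shortened tree. Averaged over [Q], the values for the
    two types add up to [1 + 2^-1] after a probe and to at most 1 for an immediate answer. *)
Definition kept (Q : sample) (ty : bool) b i z1 (t : tree) : R :=
  match t with
  | Answer a => (ohead a == Some ty)%:R
  | Probe a _ => if ty then (if popular b i z1 a then 2^-1 else 1)
                 else (if popular b i z1 a then 1 else 2^-1 * sample_weight Q a)
  end.

Definition skip_tree (Q : sample) (ty : bool) b i z1 (cQ : 'I_s -> word) (cp : 'I_theta -> word)
    (t : tree) : tree :=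
  map_tree behead (if ty then skip_probe (popular_cells b i z1) cp t else skip_probe Q cQ t).

Lemma kept_ge0 Q ty b i z1 t : 0 <= kept Q ty b i z1 t.
Proof.
case: t => [a|a k] /=; first by rewrite ler0n.
by case: ty; case: ifP => // _; rewrite ?invr_ge0// mulr_ge0 ?invr_ge0 ?sample_weight_ge0.
Qed.

Lemma kept_le_mult Q ty b i z1 t : kept Q ty b i z1 t <= mult Q ty b i z1 t.
Proof.
case: t => [a|a k]; first by rewrite /kept /mult /=; case: eqP.
rewrite /kept /mult /=; case: ty => /=; case: ifP => // _; first by rewrite invf_le1 ?ler1n.
by rewrite ler_piMl ?sample_weight_ge0// invf_le1 ?ler1n.
Qed.

Lemma mult_true Q b i z1 t : mult Q true b i z1 t = 1.
Proof. by rewrite /mult; case: (first_probe t). Qed.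

Lemma avg_mult ty b i z1 t : avg (fun Q => mult Q ty b i z1 t) = 1.
Proof.
have c1 : avg (fun _ : sample => 1) = 1 :> R.
  by apply: avg_const; rewrite card_ffun !card_ord expn_gt0 S_gt0.
rewrite /mult; case: (first_probe t) => // a; case: (ty || popular b i z1 a) => //.
exact: avg_sample_weight.
Qed.

(** The delicate case is type [false] with an unpopular first probe: either the sample contains the
    cell and the probe is saved, or [sample_weight] is 0 and both sides vanish. *)
Lemma score_skip_tree Q ty b i z1 (m : memory S w) t p :
  mult Q ty b i z1 t * score R m t (ty :: p) <=
  kept Q ty b i z1 t *
    score R m (skip_tree Q ty b i z1 (fun j => m (Q j)) (fun k => m (popular_cells b i z1 k)) t) p.
Proof.
case: t => [a|a k]; first by rewrite /mult /= mul1r /skip_tree;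
  have := score_behead R m (Answer S w a) ty p; case: ty.
have ge0 t := score_ge0 R m t p.
rewrite /mult /kept /=; case: ty => /=.
- rewrite mul1r (score_skip R (popular_cells b i z1)) /=.
  set t' := (X in score R m X _); rewrite -/t'.
  have h := score_behead_le R m t' true p.
  case: ifP => [|nE]; case: ifP => pa.
  + by rewrite ler_wpM2l ?invr_ge0.
  + by move=> _; rewrite mul1r; apply: (le_trans _ h); rewrite ler_piMl ?score_ge0// invf_le1
    ?ler1n.
  + by rewrite (popular_cellsP pa) in nE.
  + by rewrite !mul1r.
- rewrite (score_skip R Q) /=.
  set t' := (X in score R m X _); rewrite -/t'.
  have h := score_behead_le R m t' false p.
  have [pa|pa] := boolP (popular b i z1 a); have [eQ|eQ] := boolP [exists j, Q j == a];
    rewrite ?mul1r.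
  + by apply: le_trans h; rewrite ler_piMl ?score_ge0// invf_le1 ?ler1n.
  + exact: h.
  + by rewrite mulrCA -[leRHS]mulrA ler_pM2l ?invr_gt0//; apply: ler_wpM2l;
    rewrite ?sample_weight_ge0.
  + rewrite (_ : sample_weight Q a = 0) ?mulr0 ?mul0r// /sample_weight big1 ?mulr0// => j _.
    by case: eqP => // e; case/negP: eQ; apply/existsP; exists j; rewrite e.
Qed.

Definition total Q b i u := mass b i u (mult Q false b i u).
Definition excess Q b i u : R := Num.max 0 (total Q b i u - 1).

(** A second moment bound. [total - 1] is at most the mean of [s] independent centred variables
    [f (Q j)]. Each has variance at most [S / theta], since unpopular cells have [rho] below
    [1 / theta]; the mean thus has variance at most [S / (theta ^ 2 * #|I|) <= eta ^ 2]. *)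
Lemma avg_excess b i u : avg (fun Q => excess Q b i u) <= eta.
Proof.
pose r' a := rho b i u a * (~~ popular b i u a)%:R.
pose f a := S%:R * r' a - avg (fun a => S%:R * r' a).
have r'0 a : 0 <= r' a by rewrite mulr_ge0 ?rho_ge0.
have r'le a : r' a <= theta%:R^-1.
  rewrite /r'; case: (boolP (popular b i u a)); rewrite /popular ?mulr0 ?invr_ge0//= mulr1.
  by rewrite -ltNge => /ltW.
have sr' : \sum_a r' a <= 1.
  apply: le_trans (sum_rho_le1 b i u); apply: ler_sum => a _.
  by rewrite ler_piMr ?rho_ge0//; case: popular.
have s0 : (0 < s)%N by rewrite muln_gt0 theta_gt0; apply/card_gt0P; exists i.
have sR : 0 < s%:R :> R by rewrite ltr0n.
have SR : 0 < S%:R :> R by rewrite ltr0n.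
have f0 : avg f = 0.
  by rewrite /f (avgD _ (fun=> - _)) avg_const ?card_ord// subrr.
have tot Q : total Q b i u - 1 <= s%:R^-1 * \sum_j f (Q j).
  (* The part of the mass that does not vary with the sample: immediate answers and popular first
     probes. *)
  pose base := mass b i u (fun t => 1 - \sum_(a | ~~ popular b i u a) hit a t).
  have e1 : total Q b i u = base + \sum_a r' a * sample_weight Q a.
    rewrite /base /total.
    transitivity (mass b i u (fun t => (1 - \sum_(a | ~~ popular b i u a) hit a t) +
        \sum_(a | ~~ popular b i u a) sample_weight Q a * hit a t)).
      apply: eq_avg => z; apply: eq_bigr => r _; congr (_ * _).
      rewrite /mult /hit; case: (first_probe _) => [a|];
        last by rewrite !big1 ?subr0 ?addr0// => *; rewrite mulr0.
      have [pa|pa] := boolP (popular b i u a).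
        rewrite !big1 ?subr0 ?addr0//= => a' pa'; rewrite -[_ == _]/(a == a');
        by case: eqP => e; rewrite ?mulr0//; rewrite -e pa in pa'.
      rewrite !(bigD1 a pa)//= !eqxx !big1 ?addr0 ?subrr ?add0r ?mulr1//= => a' /andP[_];
      by rewrite -[_ == Some _]/(a == a') eq_sym => /negbTE ->; rewrite ?mulr0.
    rewrite massD; congr (_ + _).
    transitivity (mass b i u (fun t => \sum_a (sample_weight Q a * (~~ popular b i u a)%:R) * hit a
      t)).
      apply: eq_avg => z; apply: eq_bigr => r _; congr (_ * _); rewrite big_mkcond.
      by apply: eq_bigr => a _; case: popular; rewrite /= ?mulr0 ?mul0r ?mulr1.
    rewrite mass_sum; apply: eq_bigr => a _; rewrite massZ /r' -/(rho b i u a); ring.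
  have e2 : base + \sum_a r' a <= 1.
    have -> : \sum_a r' a = mass b i u (fun t => \sum_(a | ~~ popular b i u a) hit a t).
      rewrite [in RHS]/mass; under [in RHS]eq_avg => z do
        under eq_bigr => r _ do rewrite big_mkcond.
      rewrite -/(mass b i u (fun t => \sum_a (if ~~ popular b i u a then hit a t else 0))).
      rewrite mass_sum; apply: eq_bigr => a _; rewrite /r'.
      by case: popular; rewrite /= ?mulr1// mulr0 /mass /avg big1 ?mulr0// => z _;
        rewrite big1// => r _; rewrite mulr0.
    by rewrite /base -massD; apply: mass_le1 => t; rewrite subrK.
  have e3 : s%:R^-1 * \sum_j f (Q j) = \sum_a r' a * sample_weight Q a - \sum_a r' a.
    rewrite /f sumrB sumr_const card_ord avgZl mulrBr; congr (_ - _).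
      rewrite -mulr_sumr mulrCA; under [RHS]eq_bigr => a _ do rewrite /sample_weight mulrCA
        mulr_sumr.
      rewrite -mulr_sumr exchange_big -mulrA; congr (_ * (_ * _)); apply: eq_bigr => j _.
      rewrite (bigD1 (Q j))//= eqxx mulr1 big1 ?addr0// => a; rewrite eq_sym => /negbTE ->.
      by rewrite mulr0.
    rewrite -[_ *+ _]mulr_natl /avg card_ord; field.
    by rewrite !gt_eqF.
  rewrite e1 e3; lra.
have W2 : avg (fun Q : sample => (s%:R^-1 * \sum_j f (Q j)) ^+ 2) <= eta ^+ 2.
  under eq_avg => Q do rewrite exprMn.
  rewrite avgZl (avg_ffun_var _ f0) card_ord.
  have vf : avg (fun a => f a ^+ 2) <= S%:R / theta%:R.
    apply: (@le_trans _ _ (avg (fun a => (S%:R * r' a) ^+ 2))).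
      pose mu := avg (fun a => S%:R * r' a).
      have -> : avg (fun a => f a ^+ 2) =
                avg (fun a => (S%:R * r' a) ^+ 2 + ((- (2 * mu)) * (S%:R * r' a) + mu ^+ 2)).
        by apply: eq_avg => a; rewrite /f -/mu; ring.
      rewrite !avgD avg_const ?card_ord// avgZl -/mu; have := sqr_ge0 mu; lra.
    apply: (@le_trans _ _ (avg (fun a => (S%:R ^+ 2 / theta%:R) * r' a))).
      apply: ler_avg => a; rewrite exprMn -mulrA ler_wpM2l ?sqr_ge0// expr2.
      by rewrite ler_wpM2r.
    rewrite avgZl /avg card_ord.
    have -> : S%:R ^+ 2 / theta%:R * (S%:R^-1 * \sum_x r' x) = S%:R / theta%:R * \sum_x r' x.
      by field; rewrite !pnatr_eq0 -!lt0n theta_gt0.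
    by rewrite ler_piMr// divr_ge0.
  have t0 : 0 < theta%:R :> R by rewrite ltr0n.
  apply: (@le_trans _ _ ((s%:R)^-1 * (S%:R / theta%:R))).
    rewrite expr2 -!mulrA ler_wpM2l ?invr_ge0//.
    by rewrite mulrA mulVf ?mul1r ?gt_eqF.
  rewrite mulrC -mulrA -invfM ler_pdivrMr ?mulr_gt0//.
  apply: le_trans S_le _; rewrite ler_wpM2l ?sqr_ge0// /s -natrM ler_nat; lia.
(* The inequality [W <= W ^ 2 / (2 * eta) + eta / 2] takes the place of Cauchy-Schwarz. *)
apply: (@le_trans _ _ (avg (fun Q : sample =>
    (2 * eta)^-1 * (s%:R^-1 * \sum_j f (Q j)) ^+ 2 + eta / 2))).
  apply: ler_avg => Q; have := tot Q; move: (s%:R^-1 * _) => W hW.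
  have hh : W <= (2 * eta)^-1 * W ^+ 2 + eta / 2.
    rewrite -subr_ge0 (_ : _ - _ = (2 * eta)^-1 * (W - eta) ^+ 2).
      by rewrite mulr_ge0 ?sqr_ge0// invr_ge0 mulr_ge0// ltW.
    by field; rewrite gt_eqF.
  rewrite ge_max; apply/andP; split; last exact: le_trans hW hh.
  have e0 := ltW eta_gt0; apply: addr_ge0; apply: mulr_ge0; rewrite ?invr_ge0 ?sqr_ge0//;
    exact: mulr_ge0.
rewrite avgD (avgZl (2 * eta)^-1) avg_const; last by rewrite card_ffun !card_ord expn_gt0 S_gt0.
rewrite [leRHS](_ : _ = (2 * eta)^-1 * eta ^+ 2 + eta / 2); last by field; rewrite gt_eqF.
by rewrite lerD2r ler_pM2l ?invr_gt0 ?mulr_gt0.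
Qed.

(* The total weight may exceed 1 for some samples; [avg_excess] bounds the loss. *)
Definition normaliser (Q : sample) (sg : bool * Z) b i u : R :=
  if sg.1 then 1 else Num.max 1 (total Q b i u).

(** The noise [z] joins the auxiliary index [r], so the next level may use a different tree for
    every value of it. Dividing by [normaliser] keeps the total weight at most 1, as [bounded]
    requires. *)
Definition new_weight (Q : sample) (sg : bool * Z) b i u (zr : Z * J) : R :=
  Zn^-1 * (c b i (make_query sg u zr.1) zr.2 *
    kept Q sg.1 b i (make_query sg u zr.1).1 (tr b i (make_query sg u zr.1) zr.2)) / normaliser Q
      sg b i u.

Definition new_tree (Q : sample) (sg : bool * Z) b i u cQ cp (zr : Z * J) : tree :=
  skip_tree Q sg.1 b i (make_query sg u zr.1).1 cQ cp (tr b i (make_query sg u zr.1) zr.2).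

Lemma normaliser_ge1 Q sg b i u : 1 <= normaliser Q sg b i u.
Proof. by rewrite /normaliser; case: ifP => _; rewrite ?lexx// le_max lexx. Qed.

Lemma normaliser_gt0 Q sg b i u : 0 < normaliser Q sg b i u.
Proof. by apply: lt_le_trans (normaliser_ge1 Q sg b i u). Qed.

Lemma new_weight_ge0 Q sg b i u zr : 0 <= new_weight Q sg b i u zr.
Proof.
by rewrite /new_weight !mulr_ge0 ?kept_ge0 ?c_ge0 ?invr_ge0 ?(ltW (normaliser_gt0 _ _ _ _ _))//
  ler0n.
Qed.

Lemma sum_new_weight Q sg b i u (h : Z -> J -> R) :
  normaliser Q sg b i u * \sum_zr new_weight Q sg b i u zr * h zr.1 zr.2 =
  avg (fun z => \sum_r c b i (make_query sg u z) r *
    kept Q sg.1 b i (make_query sg u z).1 (tr b i (make_query sg u z) r) * h z r).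
Proof.
rewrite /avg -/Zn mulr_sumr mulr_sumr.
rewrite -(pair_bigA _ (fun z r => normaliser Q sg b i u * (new_weight Q sg b i u (z, r) * h z r)))
  /=.
apply: eq_bigr => z _; rewrite mulr_sumr; apply: eq_bigr => r _; rewrite /new_weight /=.
have := normaliser_gt0 Q sg b i u; move: (normaliser _ _ _ _ _) => N N0.
have Zn0 : Zn != 0 by rewrite pnatr_eq0 -lt0n.
by field; rewrite Zn0 gt_eqF.
Qed.

Lemma sum_new_weight_le1 Q sg b i u : \sum_zr new_weight Q sg b i u zr <= 1.
Proof.
have N0 := normaliser_gt0 Q sg b i u.
rewrite -(ler_pM2l N0) mulr1.
under eq_bigr => zr _ do rewrite -[new_weight _ _ _ _ _ _]mulr1.
rewrite (sum_new_weight Q sg b i u (fun _ _ => 1)).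
case: sg N0 => -[] h N0.
- rewrite /normaliser /make_query /=; apply: avg_le => // z; apply: le_trans (c_le1 b i (h, u)).
  apply: ler_sum => r _; rewrite mulr1 ler_piMr//.
  by apply: le_trans (kept_le_mult _ _ _ _ _ _) _; rewrite mult_true.
- apply: (@le_trans _ _ (total Q b i u)); last by rewrite /normaliser /= le_max lexx orbT.
  apply: ler_avg => z; apply: ler_sum => r _; rewrite mulr1 /make_query /=.
  by apply: ler_wpM2l => //; apply: kept_le_mult.
Qed.

(** Weighting by [mult] is free on average over [Q]; then [score_skip_tree] applies for each [Q].
    Removing the factor [normaliser] costs at most [excess], because the remaining sum is at most
    1. *)
Lemma avg_query_le sg b i u (m : memory S w) p :
  avg (fun z => \sum_r c b i (make_query sg u z) r * score R m (tr b i (make_query sg u z) r)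
    (sg.1 :: p)) <=
  avg (fun Q => \sum_zr new_weight Q sg b i u zr *
    score R m (new_tree Q sg b i u (fun j => m (Q j)) (fun k =>
      m (popular_cells b i (make_query sg u zr.1).1 k)) zr) p)
  + eta.
Proof.
pose rhs (Q : sample) := \sum_zr new_weight Q sg b i u zr *
  score R m (new_tree Q sg b i u (fun j => m (Q j)) (fun k =>
    m (popular_cells b i (make_query sg u zr.1).1 k)) zr) p.
apply: (@le_trans _ _ (avg (fun Q => rhs Q + excess Q b i u))); last first.
  by rewrite avgD lerD2l avg_excess.
apply: (@le_trans _ _ (avg (fun Q => avg (fun z => \sum_r c b i (make_query sg u z) r *
    (mult Q sg.1 b i (make_query sg u z).1 (tr b i (make_query sg u z) r) *
     score R m (tr b i (make_query sg u z) r) (sg.1 :: p)))))).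
  rewrite exchange_avg; apply: ler_avg => z; rewrite avg_sum; apply: ler_sum => r _.
  by rewrite avgZl avgZr avg_mult mul1r.
apply: ler_avg => Q.
apply: (@le_trans _ _ (normaliser Q sg b i u * rhs Q)).
  pose h z r := score R m (new_tree Q sg b i u (fun j => m (Q j))
    (fun k => m (popular_cells b i (make_query sg u z).1 k)) (z, r)) p.
  have -> : rhs Q = \sum_zr new_weight Q sg b i u zr * h zr.1 zr.2.
    by apply: eq_bigr => -[].
  rewrite sum_new_weight; apply: ler_avg => z; apply: ler_sum => r _.
  by rewrite -mulrA; apply: ler_wpM2l => //; apply: score_skip_tree.
have r1 : rhs Q <= 1.
  apply: le_trans (sum_new_weight_le1 Q sg b i u); apply: ler_sum => zr _.
  by rewrite ler_piMr ?new_weight_ge0 ?score_le1.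
have N1 := normaliser_ge1 Q sg b i u.
have e0 : normaliser Q sg b i u - 1 <= excess Q b i u.
  rewrite /normaliser /excess; case: ifP => _; first by rewrite subrr le_max lexx.
  by rewrite lerBlDr ge_max -!lerBlDr subrr !le_max !lexx orbT.
nra.
Qed.

Definition mean_weight Q b i sg : R := avg (fun u => \sum_zr new_weight Q sg b i u zr).

Lemma mean_weight01 Q b i sg : 0 <= mean_weight Q b i sg <= 1.
Proof.
rewrite avg_ge0/= => [|u]; last by apply: sumr_ge0 => zr _; apply: new_weight_ge0.
by apply: avg_le => // u; apply: sum_new_weight_le1.
Qed.

(** The factor [3 / 4]. The hidden half under type [true] and the half [u] under type [false] are
    both uniform, so each query [(z1, z)] is met equally often under either type, and the two values
    of [kept] for the same tree can be added. *)
Lemma avg_mean_weight b i :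
  avg (fun Q => avg (mean_weight Q b i)) <= 3 / 4 * avg (fun x => \sum_r c b i x r).
Proof.
pose Q0 : sample := [ffun=> Ordinal S_gt0].
pose fB z1 t := avg (fun Q => kept Q false b i z1 t).
have FA Q h : mean_weight Q b i (true, h) = mass b i h (kept Q0 true b i h).
  rewrite /mean_weight /mass; apply: eq_avg => u.
  have := sum_new_weight Q (true, h) b i u (fun _ _ => 1); rewrite /normaliser mul1r.
  under eq_bigr => zr _ do rewrite mulr1.
  move=> ->; rewrite /make_query /= avg_const//; apply: eq_bigr => r _; rewrite mulr1.
  by congr (_ * _); rewrite /kept; case: (tr _ _ _ _).
have FB Q h : mean_weight Q b i (false, h) <= avg (fun u => mass b i u (kept Q false b i u)).
  apply: ler_avg => u; have N1 := normaliser_ge1 Q (false, h) b i u.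
  have := sum_new_weight Q (false, h) b i u (fun _ _ => 1).
  under eq_bigr => zr _ do rewrite mulr1.
  have s0 : 0 <= \sum_zr new_weight Q (false, h) b i u zr by apply: sumr_ge0 => zr _;
    apply: new_weight_ge0.
  have -> : avg (fun z => \sum_r c b i (make_query (false, h) u z) r *
      kept Q (false, h).1 b i (make_query (false, h) u z).1 (tr b i (make_query (false, h) u z) r)
        * 1) =
      mass b i u (kept Q false b i u).
    by apply: eq_avg => z; apply: eq_bigr => r _; rewrite mulr1.
  by move=> <-; rewrite ler_peMl.
rewrite avg_pair.
apply: (@le_trans _ _ ((avg (fun h => mass b i h (kept Q0 true b i h)) +
                        avg (fun h => mass b i h (fB h))) / 2)).
  rewrite exchange_avg avg_pair avg_bool ler_pM2r ?invr_gt0//; apply: lerD.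
    apply: ler_avg => h; apply: avg_le => [|Q]; last by rewrite FA.
    by apply: mass_ge0 => t; apply: kept_ge0.
  apply: avg_le => [|h].
    by apply: avg_ge0 => h; apply: mass_ge0 => t; apply: avg_ge0 => Q; apply: kept_ge0.
  apply: (@le_trans _ _ (avg (fun Q => avg (fun u => mass b i u (kept Q false b i u))))).
    exact: ler_avg.
  by rewrite exchange_avg; apply: ler_avg => u; rewrite mass_avg.
rewrite -avgD -avgZr -avgZl; apply: ler_avg => z1.
rewrite -massD -[X in X / 2]mul1r mulrAC -massZ /mass.
rewrite -avgZl; apply: ler_avg => z; rewrite mulr_sumr; apply: ler_sum => r _.
rewrite mulrC ler_wpM2r//; set t := tr _ _ _ _.
have fBE : fB z1 t = match t with Answer a => (ohead a == Some false)%:R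
    | Probe a _ => if popular b i z1 a then 1 else 2^-1 end.
  have c1 (x : R) : avg (fun _ : sample => x) = x.
    by apply: avg_const; rewrite card_ffun !card_ord expn_gt0 S_gt0.
  rewrite /fB /kept; case: t => [a|a k]; rewrite ?c1//.
  by case: (popular b i z1 a); rewrite ?c1// avgZl (avg_sample_weight i) mulr1.
rewrite fBE /kept; case: t {fBE} => [a|a k]; last by case: popular; lra.
by case: a => [|[] a] /=; lra.
Qed.

End StepBody.

(** * One level of the round elimination *)

Section StepBounded.
Variables (R : realType) (S w : nat) (eta : R) (g theta : nat) (P : problem R).
Hypotheses (S_gt0 : (0 < S)%N) (g_gt0 : (0 < g)%N) (theta_gt0 : (0 < theta)%N).
Hypotheses (eta_gt0 : 0 < eta) (eta_le : eta <= 2^-1).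
Hypothesis qry_gt0 : (0 < #|qry P|)%N.
Hypothesis ker_ge0 : forall (y : inp P) x, 0 <= ker y x.
Hypothesis ker_le1 : forall y : inp P, \sum_x ker y x <= 1.
Local Notation Z := ('I_g * qry P)%type.
Local Notation word := (w.-tuple bool).
Local Notation data I := {ffun I * 'I_g -> inp P}.
Local Notation coins I := {ffun I -> bool * Z}.
Local Notation samples s := {ffun 'I_s -> 'I_S}.

(** For fixed coins and sample, the hypothesis on [P] applies to the [#|I| * g] copies after at most
    [2 * theta * w] bits per root have been published. The loss [4 * eta] consists of [eta] from
    [avg_excess] and [3 * eta] for the dependence of the coins on the public value. *)
Lemma bounded_step U H alpha alpha' v e :
  0 <= v -> v <= 1 -> alpha' <= alpha * g%:R -> alpha' <= eta ^+ 2 * theta%:R ^+ 2 ->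
  (2 * theta * w)%:R + eta ^+ 2 <= eta ^+ 2 * g%:R ->
  bounded S w eta P alpha v e ->
  bounded S w eta (step g U H P) alpha' (3 / 4 * v) (e + 4 * eta).
Proof.
move=> v0 v1 al_g al_t cap IH I B J pub mem c tr S_le lnB c0 c1.
have gR : 0 < g%:R :> R by rewrite ltr0n.
have I0 : 0 <= #|I|%:R :> R by rewrite ler0n.
have S_le' : S%:R <= eta ^+ 2 * (theta ^ 2 * #|I|)%:R.
  by apply: (le_trans S_le); rewrite natrM natrX mulrA ler_wpM2r.
set s := (theta * #|I|)%N.
pose CC := @new_weight R S w g theta P I B J c tr.
pose NT := @new_tree R S w g theta P S_gt0 I B J c tr.
pose PC := @popular_cells R S w g theta P S_gt0 I B J c tr.
pose FP := @mean_weight R S w g theta P I B J c tr.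
pose pubj sg (D : data I) := pub (join sg D).
have cQ : (0 < #|{: samples s}|)%N by rewrite card_ffun !card_ord expn_gt0 S_gt0.
have csg : (0 < #|{: coins I}|)%N.
  by rewrite card_ffun expn_gt0 card_prod card_bool muln_gt0 (card_Z_gt0 g_gt0 qry_gt0).
pose A (Q : samples s) (sg : coins I) (D : data I) i (u : Z) :=
  let b := pubj sg D in let m := mem (join sg D) in
  \sum_zr CC Q (sg i) b i u zr *
    score R m (NT Q (sg i) b i u (fun j => m (Q j))
      (fun k => m (PC b i (sg i).2 k)) zr) (pth (D (i, u.1)) u.2).
pose X := avg (fun sg : coins I => avg (fun D : data I =>
  \sum_i \sum_(u : Z) g%:R^-1 * ker (D (i, u.1)) u.2 *
  (avg (fun Q : samples s => A Q sg D i u) + eta))).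
apply: (@le_trans _ _ X).
  rewrite avg_join; apply: ler_avg => sg; apply: ler_avg => D.
  apply: ler_sum => i _.
  rewrite (sum_step_ker g_gt0 qry_gt0 (join sg D i) (fun x =>
    \sum_r c (pub (join sg D)) i x r *
    score R (mem (join sg D)) (tr (pub (join sg D)) i x r) (step_pth (join sg D i) x))).
  apply: ler_sum => u _; rewrite ffunE /= ffunE.
  apply: ler_wpM2l; first by rewrite mulr_ge0 ?invr_ge0 ?ker_ge0// ltW.
  have -> : avg (fun Q : samples s => A Q sg D i u) = avg
    (fun Q : samples s => \sum_zr CC Q (sg i) (pubj sg D) i u zr *
      score R (mem (join sg D)) (NT Q (sg i) (pubj sg D) i u (fun j => mem (join sg D) (Q j))
      (fun k => mem (join sg D) (PC (pubj sg D) i (make_query (sg i) u zr.1).1 k)) zr)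
        (pth (D (i, u.1)) u.2)).
    apply: eq_avg => Q; apply: eq_bigr => zr _; congr (_ * score R _ _ _).
    by rewrite /NT /new_tree /skip_tree /make_query; case: (sg i) => -[].
  apply: le_trans (avg_query_le S_gt0 g_gt0 theta_gt0 eta_gt0 qry_gt0 tr c0 c1 S_le' _ _ _ _ _ _).
  apply: ler_avg => z; apply: ler_sum => r _; apply: ler_wpM2l => //.
  rewrite /step_pth /make_query /=; case: (sg i) => -[] h /=; by rewrite ffunE.
have kerI (D : data I) : \sum_(i : I) \sum_(u : Z) g%:R^-1 * ker (D (i, u.1)) u.2 * eta <=
  #|I|%:R * eta.
  rewrite mulr_natl -sumr_const; apply: ler_sum => i _.
  rewrite -(pair_bigA _ (fun a x => g%:R^-1 * ker (D (i, a)) x * eta)) /=.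
  apply: (@le_trans _ _ (\sum_(a < g) g%:R^-1 * eta)).
    apply: ler_sum => a _; rewrite -mulr_suml -mulr_sumr.
    rewrite ler_pM2r// ler_piMr ?invr_ge0 ?ker_le1// ltW//.
  by rewrite sumr_const card_ord -[(_ * eta) *+ _]mulr_natl mulrA mulfV ?mul1r// gt_eqF.
pose Y (Q : samples s) := avg (fun sg : coins I => avg (fun D : data I =>
  \sum_i avg (fun u => \sum_zr CC Q (sg i) (pubj sg D) i u zr))).
apply: (@le_trans _ _ (avg (fun Q : samples s => v * Y Q) + (e + eta) * #|I|%:R)).
  apply: (@le_trans _ _ (avg (fun sg : coins I => avg (fun D : data I => avg (fun Q : samples s =>
      \sum_i \sum_(u : Z) g%:R^-1 * ker (D (i, u.1)) u.2 * A Q sg D i u) + #|I|%:R * eta)))).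
    apply: ler_avg => sg; apply: ler_avg => D.
    apply: le_trans (lerD (lexx _) (kerI D)).
    rewrite avg_sum -big_split; apply: ler_sum => i _ /=.
    rewrite avg_sum -big_split; apply: ler_sum => u _ /=.
    by rewrite mulrDr avgZl.
  apply: (@le_trans _ _ (avg (fun sg : coins I => avg (fun Q : samples s => avg (fun D : data I =>
      \sum_i \sum_(u : Z) g%:R^-1 * ker (D (i, u.1)) u.2 * A Q sg D i u)) + #|I|%:R * eta))).
    apply: ler_avg => sg; rewrite avgD exchange_avg lerD2l.
    by apply: avg_le => //; rewrite mulr_ge0// ltW.
  have -> : avg (fun Q : samples s => v * Y Q) = avg (fun sg : coins I => avg (fun Q : samples s =>
     v * avg (fun D : data I => \sum_i avg (fun u => \sum_zr CC Q (sg i) (pubj sg D) i u zr)))).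
    by rewrite exchange_avg; apply: eq_avg => Q; rewrite avgZl.
  apply: (@le_trans _ _ (avg (fun sg : coins I => avg (fun Q : samples s =>
     v * avg (fun D : data I => \sum_i avg (fun u => \sum_zr CC Q (sg i) (pubj sg D) i u zr))) +
     (e + eta) * #|I|%:R))); last first.
    by rewrite avgD (avg_const _ csg).
  apply: ler_avg => sg.
  rewrite mulrDl addrA [_ * eta]mulrC lerD2r.
  rewrite -[X in _ <= _ + X](avg_const (T := samples s)) // -avgD.
  apply: ler_avg => Q.
  (* Published to the next level: the old value, the contents of the sampled cells, and for each
     root the contents of the popular cells of its hidden half. *)
  pose B' : finType := (B * {ffun 'I_s -> word} * {ffun I -> {ffun 'I_theta -> word}})%type.
  pose pub' (D : data I) : B' :=
    (pubj sg D, [ffun j => mem (join sg D) (Q j)],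
     [ffun i => [ffun k => mem (join sg D) (PC (pubj sg D) i (sg i).2 k)]]).
  pose c' (b : B') (ia : I * 'I_g) x zr := CC Q (sg ia.1) b.1.1 ia.1 (ia.2, x) zr.
  pose tr' (b : B') (ia : I * 'I_g) x zr :=
    NT Q (sg ia.1) b.1.1 ia.1 (ia.2, x) (b.1.2) (b.2 ia.1) zr.
  have cI : #|{: I * 'I_g}|%:R = g%:R * #|I|%:R :> R by rewrite card_prod card_ord natrM mulrC.
  have lnw (n : nat) : ln (2 ^ n)%:R <= n%:R :> R.
    rewrite -[leRHS]expRK ler_ln ?posrE ?ltr0n ?expn_gt0 ?expR_gt0//.
    rewrite -[X in expR X]mulr1 expRM_natl natrX; apply: lerXn2r; rewrite ?nnegrE ?expR_ge0//.
    by have := @expR_ge1Dx R 1.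
  have B0 : #|B|%:R = 0 :> R \/ 0 < #|B|%:R :> R.
    by have [->|h] := posnP #|B|; [left|right; rewrite ltr0n].
  have lnB' : ln #|B'|%:R <= eta ^+ 2 * #|{: I * 'I_g}|%:R.
    rewrite cI !card_prod !card_ffun !card_ord !card_tuple card_bool -!expnM !natrM.
    case: B0 => [->|B0].
      by rewrite !mul0r ln0// mulr_ge0 ?sqr_ge0// mulr_ge0// ltW.
    have p2 n : 0 < (2 ^ n)%:R :> R by rewrite ltr0n expn_gt0.
    rewrite lnM ?posrE ?p2 ?mulr_gt0// lnM ?posrE ?p2//.
    apply: (le_trans (lerD (lerD lnB (lnw _)) (lnw _))).
    have := ler_wpM2r I0 cap; rewrite /s !natrM; lra.
  have S_le2 : S%:R <= alpha * #|{: I * 'I_g}|%:R.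
    by rewrite cI mulrA; apply: (le_trans S_le); apply: ler_wpM2r.
  have := IH _ _ _ pub' (fun D => mem (join sg D)) c' tr' S_le2 lnB'
    (fun b ia x zr => new_weight_ge0 tr c0 _ _ _ _ _ _)
    (fun b ia x => sum_new_weight_le1 g_gt0 qry_gt0 tr c0 c1 _ _ _ _ _).
  rewrite cI -(ler_pM2l (_ : 0 < g%:R^-1)) ?invr_gt0// => h.
  apply: le_trans (le_trans h _).
    rewrite -avgZl; apply: ler_avg => D.
    rewrite (sum_pairE (fun ia : I * 'I_g => \sum_x _)).
    rewrite mulr_sumr; apply: ler_sum => i _; rewrite mulr_sumr.
    rewrite (sum_pairE (fun u : Z => _ * _)).
    apply: ler_sum => a _; rewrite mulr_sumr; apply: ler_sum => x _.
    rewrite -mulrA le_eqVlt; apply/orP; left; apply/eqP; congr (_ * (_ * _)).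
    apply: eq_bigr => zr _; rewrite /c' /tr' /pub' /=; congr (_ * score R _ (NT _ _ _ _ _ _ _ _) _).
      by apply/funext => j; rewrite ffunE.
    by apply/funext => k; rewrite !ffunE.
  rewrite mulrDr; apply: lerD; last by rewrite mulrCA mulKf// gt_eqF.
  rewrite mulrCA; apply: ler_wpM2l => //; rewrite -avgZl; apply: ler_avg => D.
  rewrite sum_pairE mulr_sumr; apply: ler_sum => i _.
  by rewrite [leRHS]avg_pair /avg card_ord.
have FPle Q : Y Q <= avg (fun sg : coins I => avg (fun D : data I =>
  \sum_i avg (FP Q (pubj sg D) i))) + 3 * eta * #|I|%:R.
  rewrite /Y exchange_avg [X in _ <= X + _]exchange_avg.
  have c3 : 0 <= 3 * eta * #|I|%:R by rewrite !mulr_ge0// ltW.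
  apply: (@le_trans _ _ (avg (fun D : data I => avg (fun sg : coins I =>
    \sum_i avg (FP Q (pubj sg D) i)) + 3 * eta * #|I|%:R))); last first.
    by rewrite avgD lerD2l; apply: avg_le.
  apply: ler_avg => D.
  (* For fixed [D] the public value is a function of the independent coins, which may therefore be
     redrawn. The bound on [ln #|B|] makes the cost [eta + 2 * eta] per root. *)
  have := @avg_union_bound R I _ B (fun sg => pubj sg D) (FP Q) eta eta_gt0 eta_le.
  move=> /(_ (fun b i sg => mean_weight01 g_gt0 qry_gt0 tr c0 c1 Q b i sg)) h; apply: (le_trans h).
  rewrite lerD2l.
  have : ln #|B|%:R / eta <= eta * #|I|%:R.
    by rewrite ler_pdivrMr// (le_trans lnB)// expr2 mulrAC.
  by move=> hh; rewrite -!mulrA in hh *; lra.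
apply: (@le_trans _ _ (v * (avg (fun sg : coins I => avg
  (fun D : data I => \sum_i avg (fun Q : samples s => avg (FP Q (pubj sg D) i)))) + 3 * eta *
  #|I|%:R) + (e + eta) * #|I|%:R)).
  rewrite lerD2r avgZl; apply: ler_wpM2l => //.
  apply: (@le_trans _ _ (avg (fun Q : samples s => avg (fun sg : coins I =>
     avg (fun D : data I => \sum_i avg (FP Q (pubj sg D) i))) + 3 * eta * #|I|%:R))).
    exact: ler_avg.
  rewrite avgD (avg_const _ cQ) lerD2r exchange_avg; apply: ler_avg => sg.
  by rewrite exchange_avg; apply: ler_avg => D; rewrite avg_sum.
have last_step : avg (fun sg : coins I => avg (fun D : data I =>
    \sum_i avg (fun Q : samples s => avg (FP Q (pubj sg D) i)))) <=
  3 / 4 * avg (fun D : {ffun I -> step_inp g P} => \sum_i avg (fun x => \sum_r c (pub D) i x r)).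
  rewrite avg_join -avgZl; apply: ler_avg => sg; rewrite -avgZl; apply: ler_avg => D.
  rewrite mulr_sumr; apply: ler_sum => i _.
  exact: (avg_mean_weight S_gt0 g_gt0 theta_gt0 qry_gt0 tr c0).
have e0 : 0 <= eta * #|I|%:R by rewrite mulr_ge0// ltW.
have := ler_wpM2l v0 last_step; move: (avg _) (avg _) => x y h.
have h2 : v * (eta * #|I|%:R) <= eta * #|I|%:R by rewrite ler_piMl.
rewrite -!mulrA in h *; lra.
Qed.

End StepBounded.

(** * Positions on the line *)

Definition dist (a b : nat) : nat := (a - b + (b - a))%N.

Section Geometry.
Variable R : realType.


(** A bracket [lo], [hi] instead of the exact nearest distance, because the outer levels and the
    embedding distort distances by constant factors. *)
Definition sound (P : problem R) (U : nat) (kappa : R) : Prop :=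
  exists dec : R -> seq bool, forall (y : inp P) (x : qry P), ker y x != 0 ->
  exists lo hi : nat, [/\ (0 < lo)%N, (hi <= U)%N,
    (exists2 v, elt y v & (dist v (qpos x) <= hi)%N),
    (forall v, elt y v -> (lo <= dist v (qpos x))%N) &
    forall est : R, lo%:R / kappa <= est <= kappa * hi%:R -> dec est = pth y x].

(** [elt_avg] bounds the density of elements: about [1 / pi] independent copies can share one line
    without crowding any position. *)
Record layout (P : problem R) (U : nat) (pi : R) : Prop := Layout {
  qpos_lt : forall x : qry P, (qpos x < U)%N;
  qpos_inj : injective (@qpos _ P);
  elt_lt : forall (y : inp P) v, elt y v -> (v < U)%N;
  elt_avg : forall v, avg (fun y : inp P => (elt y v)%:R) <= pi :> R;
  kernel_ge0 : forall (y : inp P) x, 0 <= ker y x;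
  kernel_sum : forall y : inp P, \sum_x ker y x = 1;
  qry_card : (0 < #|qry P|)%N;
  inp_card : (0 < #|inp P|)%N }.

Section StepLayout.
Variables (g U H : nat) (P : problem R) (pi : R).
Hypotheses (g_gt0 : (0 < g)%N) (H_gt1 : (1 < H)%N).
Hypothesis lay : layout P U pi.
Local Notation Z := ('I_g * qry P)%type.
Local Notation cw := (cwidth g U).
Local Notation V := (stride g U H).

Lemma U_gt0 : (0 < U)%N.
Proof. by case/card_gt0P: (qry_card lay) => x _; apply: leq_ltn_trans (qpos_lt lay x). Qed.

Lemma cpos_lt (u : Z) : (cpos U u < cw)%N.
Proof.
rewrite /cpos /cwidth; have := qpos_lt lay u.2; have := ltn_ord u.1.
move: (nat_of_ord u.1) (qpos u.2) => a b; nia.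
Qed.

Lemma cpos_inj : injective (@cpos R g U P).
Proof.
move=> [k x] [k' x'] /= /[dup] e1 /(congr1 (divn^~ (2 * U)%N)).
have U0 := U_gt0; rewrite /cpos /= !divnMDl ?muln_gt0//.
rewrite !divn_small ?addn0; try by have := qpos_lt lay x; have := qpos_lt lay x'; lia.
move=> kk; move: e1; rewrite /cpos /= kk => /addnI /(qpos_inj lay) ->.
by rewrite (ord_inj kk).
Qed.

Lemma cw_le_stride : (2 * cw <= V)%N.
Proof. by rewrite /stride leq_mul2r H_gt1 orbT. Qed.

Lemma cw_gt0 : (0 < cw)%N.
Proof. by rewrite /cwidth !muln_gt0 g_gt0 U_gt0. Qed.

Lemma stride_gt0 : (0 < V)%N.
Proof. by have := cw_le_stride; have := cw_gt0; lia. Qed.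

Lemma sub_eltP (f : {ffun 'I_g -> inp P}) a : sub_elt U f a ->
  exists k : 'I_g, exists2 e, elt (f k) e & a = (k * (2 * U) + e)%N.
Proof.
rewrite /sub_elt; case: insubP => // k _ ka h; exists k; exists (a %% (2 * U))%N => //.
by rewrite ka -divn_eq.
Qed.

Lemma sub_eltI (f : {ffun 'I_g -> inp P}) (k : 'I_g) e :
  elt (f k) e -> sub_elt U f (k * (2 * U) + e).
Proof.
move=> fe; have eU := elt_lt lay fe; have U0 := U_gt0.
rewrite /sub_elt divnMDl ?muln_gt0// divn_small ?addn0; last lia.
case: insubP => [k' _ kk|]; last by rewrite ltn_ord.
by rewrite (ord_inj kk) modnMDl modn_small//; lia.
Qed.

Lemma sub_elt_lt (f : {ffun 'I_g -> inp P}) a : sub_elt U f a -> (a < cw)%N.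
Proof.
move=> /sub_eltP[k [e /(elt_lt lay) eU ->]]; have := ltn_ord k; rewrite /cwidth.
move: (nat_of_ord k) => b; nia.
Qed.

Lemma step_qpos_lt (x : step_qry g P) : (step_qpos U H x < cw * V)%N.
Proof.
rewrite /step_qpos; have := cpos_lt x.1; have := cpos_lt x.2; have := cw_le_stride.
by move: (cpos U x.1) (cpos U x.2) cw V => a b c d; nia.
Qed.

Lemma step_qpos_inj : injective (@step_qpos R g U H P).
Proof.
have lt (u : Z) : (cpos U u < V)%N by have := cpos_lt u; have := cw_le_stride; lia.
have V0 := stride_gt0.
move=> [x1 x2] [y1 y2] /= /[dup] e1 /(congr1 (divn^~ V)); rewrite /step_qpos /=.
rewrite !divnMDl// !divn_small// !addn0 => e2.
move: e1; rewrite /step_qpos /= e2 => /addnI /cpos_inj ->.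
by rewrite (cpos_inj e2).
Qed.

Lemma step_elt_lt (y : step_inp g P) v : step_elt U H y v -> (v < cw * V)%N.
Proof.
have V0 := stride_gt0; rewrite /step_elt; case: y.1.1 => /andP[/eqP e1].
- move=> _; have := cpos_lt y.1.2; rewrite -e1 ltn_divLR//.
- by move=> /sub_elt_lt; rewrite ltn_divLR.
Qed.

Lemma avg_sub_elt a : avg (fun f : {ffun 'I_g -> inp P} => (sub_elt U f a)%:R) <= pi.
Proof.
have pi0 : 0 <= pi.
  by apply: le_trans (elt_avg lay 0%N); apply: avg_ge0.
rewrite /sub_elt; case: insubP => [k _ _|_]; last by apply: avg_le => // f; exact: pi0.
by rewrite (avg_ffun_proj k (fun y => (elt y (a %% (2 * U))%N)%:R)); apply: (elt_avg lay).
Qed.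

Lemma avg_cpos a : avg (fun u : Z => (a == cpos U u)%:R) <= #|{: Z}|%:R^-1 :> R.
Proof.
rewrite /avg ler_piMr ?invr_ge0//.
have [[u /eqP au]|nu] := pselect (exists u : Z, a == cpos U u).
  rewrite (bigD1 u)//= au eqxx big1 ?addr0// => u' u'u.
  by case: eqP => // /cpos_inj e; rewrite e eqxx in u'u.
by rewrite big1// => u _; case: eqP => // au; case: nu; exists u; rewrite au.
Qed.

(** For both types the uniform [y.1.2] fixes one digit of every element, which divides the density
    by [#|Z|]. *)
Lemma step_elt_avg v :
  avg (fun y : step_inp g P => (step_elt U H y v)%:R) <= pi / #|{: Z}|%:R.
Proof.
have pi0 : 0 <= pi by apply: le_trans (elt_avg lay 0%N); apply: avg_ge0.
have key a b : avg (fun h : Z => avg (fun f : {ffun 'I_g -> inp P} =>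
    ((a == cpos U h) && sub_elt U f b)%:R)) <= pi / #|{: Z}|%:R.
  apply: (@le_trans _ _ (avg (fun h : Z => (a == cpos U h)%:R * pi))).
    apply: ler_avg => h; case: (a == cpos U h); rewrite ?mul1r ?mul0r/=.
      exact: avg_sub_elt.
    by apply: avg_le => // f; exact: lexx.
  by rewrite avgZr mulrC ler_wpM2l// avg_cpos.
rewrite avg_pair avg_pair avg_bool /step_elt /=.
by rewrite ler_pdivrMr//; apply: le_trans (lerD (key _ _) (key _ _)) _; rewrite mulr_natr mulr2n.
Qed.

Lemma step_kernel_ge0 (y : step_inp g P) x : 0 <= step_ker y x.
Proof.
by rewrite /step_ker; case: ifP => _; rewrite ?mulr_ge0 ?invr_ge0 ?(kernel_ge0 lay).
Qed.

Lemma step_kernel_sum (y : step_inp g P) : \sum_x step_ker y x = 1.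
Proof.
have q0 := qry_card lay.
under eq_bigr => x _ do rewrite -[step_ker _ _]mulr1.
rewrite (sum_step_ker g_gt0 q0 y (fun=> 1)).
under eq_bigr => x _ do rewrite avg_const ?(card_Z_gt0 g_gt0 q0)// mulr1.
rewrite sum_pairE /=; under eq_bigr => k _ do rewrite -mulr_sumr (kernel_sum lay) mulr1.
by rewrite sumr_const card_ord -[_ *+ _]mulr_natl mulfV// pnatr_eq0 -lt0n.
Qed.

Lemma step_layout : layout (step g U H P) (cw * V) (pi / #|{: Z}|%:R).
Proof.
split.
- exact: step_qpos_lt.
- exact: step_qpos_inj.
- exact: step_elt_lt.
- exact: step_elt_avg.
- exact: step_kernel_ge0.
- exact: step_kernel_sum.
- by rewrite card_prod muln_gt0 !card_Z_gt0 ?(qry_card lay).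
- rewrite card_prod muln_gt0 card_prod card_bool card_ffun expn_gt0 (inp_card lay).
  by rewrite muln_gt0 (card_Z_gt0 g_gt0 (qry_card lay)).
Qed.

Lemma sub_sound (f : {ffun 'I_g -> inp P}) (k : 'I_g) (x : qry P) lo hi :
  (hi <= U)%N ->
  (exists2 v, elt (f k) v & (dist v (qpos x) <= hi)%N) ->
  (forall v, elt (f k) v -> (lo <= dist v (qpos x))%N) ->
  (exists2 a, sub_elt U f a & (dist a (cpos U (k, x)) <= hi)%N) /\
  (forall a, sub_elt U f a -> (lo <= dist a (cpos U (k, x)))%N).
Proof.
move=> hiU [v fv vhi] low; split.
  exists (k * (2 * U) + v)%N; first exact: sub_eltI.
  by move: vhi; rewrite /dist /cpos /=; lia.
move=> a /sub_eltP[k' [e fe ->]]; have [kk|kk] := eqVneq k' k.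
  by have := low e; rewrite -kk => /(_ fe); rewrite /dist /cpos /=; lia.
have loU : (lo <= U)%N by have := low v fv; lia.
have eU := elt_lt lay fe; have qU := qpos_lt lay x.
have {kk} : (k' : nat) != k by apply: contraNneq kk => /ord_inj ->.
rewrite /dist /cpos /=; move: (nat_of_ord k) (nat_of_ord k') (qpos x) qU => i j q qU.
by rewrite neq_ltn => /orP[]; nia.
Qed.

Lemma dist_scale a a' b b' : (b < cw)%N -> (b' < cw)%N ->
  (dist a a' * V - cw <= dist (a * V + b) (a' * V + b') <= dist a a' * V + cw)%N.
Proof.
move=> bc b'c; rewrite /dist; have [aa|aa] := leqP a a'.
  rewrite -(subnKC aa); move: (a' - a)%N => d.
  have -> : (a - (a + d) + (a + d - a) = d)%N by lia.
  by rewrite mulnDl; move: (a * V)%N (d * V)%N => x y; lia.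
rewrite -(subnKC (ltnW aa)); move: (a - a')%N => d.
have -> : (a' + d - a' + (a' - (a' + d)) = d)%N by lia.
by rewrite mulnDl; move: (a' * V)%N (d * V)%N => x y; lia.
Qed.

(** Type [true] yields estimates of at most [kappa * U], type [false] of at least [V / (2 * kappa)],
    and [kappa ^+ 2 < H] separates them. Under type [false] the low-order digits perturb distances
    by a factor between [1 / 2] and 2 relative to [V], hence the slack [2 * kappa] asked of [P]. *)
Lemma step_sound (kappa : R) : 0 < kappa -> kappa ^+ 2 < H%:R ->
  sound P U (2 * kappa) -> sound (step g U H P) (cw * V) kappa.
Proof.
move=> k0 kH [dec decP].
have V0 := stride_gt0; have VR : 0 < V%:R :> R by rewrite ltr0n.
have cV := cw_le_stride; have c0 := cw_gt0; have U0 := U_gt0.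
have UC : (2 * U <= cw)%N by rewrite /cwidth leq_pmull.
have cVR : 2 * cw%:R <= V%:R :> R by rewrite -natrM ler_nat.
pose thr : R := V%:R / (2 * kappa).
exists (fun est => if est < thr then true :: dec est else false :: dec (est / V%:R)).
case=> -[ty h] f [x1 x2]; rewrite /= /step_ker /step_pth /=; case: ty => /=.
- have [<-{h}|_] := eqVneq x1 h; last by rewrite mul0r eqxx.
  rewrite mul1r mulf_eq0 negb_or => /andP[_ kx].
  have [lo [hi [lo0 hiU ex low dP]]] := decP _ _ kx.
  have [[a fa ahi] sl] := sub_sound hiU ex low.
  rewrite -surjective_pairing in ahi sl.
  have eqd (b : nat) : dist (cpos U x1 * V + b) (step_qpos U H (x1, x2)) = dist b (cpos U x2).
    by rewrite /step_qpos /dist /=; lia.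
  exists lo, hi; split => //.
  + by have := leq_pmulr cw V0; lia.
  + exists (cpos U x1 * V + a)%N; last by rewrite eqd.
    have aV : (a < V)%N by have := sub_elt_lt fa; lia.
    by rewrite /step_elt /= divnMDl// divn_small// addn0 eqxx modnMDl modn_small.
  + move=> v; rewrite /step_elt /= => /andP[/eqP e1 /sl h].
    by rewrite {1}(divn_eq v V) e1 eqd.
  + move=> est /andP[e1 e2]; have -> : est < thr.
      apply: (le_lt_trans e2); rewrite /thr ltr_pdivlMr ?mulr_gt0//.
      have : V%:R = H%:R * cw%:R :> R by rewrite /stride natrM.
      have h1 : hi%:R <= U%:R :> R by rewrite ler_nat.
      have h2 : 2 * U%:R <= cw%:R :> R by rewrite -natrM ler_nat.
      have U0R : 0 < U%:R :> R by rewrite ltr0n.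
      move=> ->; apply: (@le_lt_trans _ _ (kappa ^+ 2 * (2 * U%:R))); first nra.
      apply: (@lt_le_trans _ _ (H%:R * (2 * U%:R))); first by rewrite ltr_pM2r// mulr_gt0.
      by rewrite ler_wpM2l.
    congr cons; apply: dP; apply/andP; split.
      apply: le_trans e1; rewrite ler_wpM2l// lef_pV2 ?posrE ?mulr_gt0//; lra.
    by apply: (le_trans e2); rewrite ler_wpM2r//; lra.
- rewrite mulf_eq0 negb_or mulf_eq0 negb_or => /andP[/andP[_ kx] _].
  have [lo [hi [lo0 hiU ex low dP]]] := decP _ _ kx.
  have [[a fa ahi] sl] := sub_sound hiU ex low.
  rewrite -surjective_pairing in ahi sl.
  have := cpos_lt h; set b := cpos U h => bc; have b'c := cpos_lt x2.
  exists (lo * (V - cw))%N, (hi * (V + cw))%N; split.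
  + by rewrite muln_gt0 lo0 subn_gt0; lia.
  + have : (2 * hi <= cw)%N by lia.
    have : (V + cw <= 2 * V)%N by lia.
    by move: (V + cw)%N cw V => p q r; nia.
  + exists (a * V + b)%N.
      have bV : (b < V)%N by lia.
      by rewrite /step_elt /= modnMDl modn_small// eqxx divnMDl// divn_small// addn0.
    rewrite /step_qpos /=; have /andP[_ h2] := dist_scale a (cpos U x1) bc b'c.
    apply: (leq_trans h2).
    have hi0 : (0 < hi)%N.
      by apply: leq_trans ahi; apply: leq_trans lo0 (sl a fa).
    by rewrite mulnDr leq_add ?leq_mul2r ?ahi ?orbT// leq_pmull.
  + move=> v; rewrite /step_elt /= => /andP[/eqP e1 fv].
    have {fv}h1 := sl _ fv.
    rewrite {1}(divn_eq v V) e1 /step_qpos /=.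
    have /andP[h2 _] := dist_scale (v %/ V) (cpos U x1) bc b'c.
    apply: leq_trans h2; rewrite mulnBr.
    have : (lo * V <= dist (v %/ V) (cpos U x1) * V)%N by rewrite leq_mul2r h1 orbT.
    have : (cw <= lo * cw)%N by rewrite leq_pmull.
    lia.
  + move=> est /andP[e1 e2].
    have lo1 : 1 <= lo%:R :> R by rewrite ler1n.
    have VB : V%:R / 2 <= (V - cw)%:R :> R by rewrite natrB; [lra|lia].
    have VA : (V + cw)%:R <= 2 * V%:R :> R by rewrite natrD; lra.
    have -> : est < thr = false.
      apply/negbTE; rewrite -leNgt; apply: le_trans e1.
      rewrite /thr natrM invfM mulrA ler_wpM2r ?invr_ge0 ?(ltW k0)//.
      by apply: (le_trans VB); rewrite ler_peMl.
    congr cons; apply: dP; apply/andP; split.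
      rewrite ler_pdivlMr//; apply: le_trans e1.
      rewrite natrM invfM -!mulrA ler_wpM2l//.
      rewrite mulrA [_ * V%:R]mulrC mulrA ler_wpM2r ?invr_ge0 ?(ltW k0)//.
    rewrite ler_pdivrMr//; apply: (le_trans e2).
    have kh : 0 <= kappa * hi%:R by rewrite mulr_ge0// ltW.
    by have := ler_wpM2l kh VA; rewrite natrM; move: (V + cw)%:R => c; lra.
Qed.

End StepLayout.
End Geometry.

(** * Iterating the construction *)

Section Family.
Variables (R : realType) (Q H : nat).

(** The answer is empty. The element sits at 1, away from the query at 0, since [sound] asks for
    positive distances. *)
Definition base_problem : problem R :=
  @Problem R unit unit (fun _ _ => 1) (fun _ _ => [::]) (fun _ => 0%N) (fun _ v => v == 1%N).

(* [fam_bounded] maintains [S <= Q ^ (2 ^ l.+2 - 3) * roots] at level [l], and [arity l] has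
   to exceed the square root of the number of cells per root at level [l.+1]. *)
Definition arity (l : nat) : nat := (Q ^ 2 ^ l.+2)%N.

Fixpoint famU (l : nat) : nat :=
  if l is l'.+1 then (cwidth (arity l') (famU l') * stride (arity l') (famU l') H)%N else 2%N.

Fixpoint fam (l : nat) : problem R :=
  if l is l'.+1 then step (arity l') (famU l') H (fam l') else base_problem.

(** The reciprocal of the density in [fam_layout], and later the number of active colours. *)
Fixpoint famZ (l : nat) : nat :=
  if l is l'.+1 then (famZ l' * (arity l' * #|qry (fam l')|))%N else 1%N.

Hypotheses (Q_gt0 : (0 < Q)%N) (H_gt1 : (1 < H)%N).

Lemma arity_gt0 l : (0 < arity l)%N.
Proof. by rewrite expn_gt0 Q_gt0. Qed.

Lemma base_layout : layout base_problem 2 1.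
Proof.
split => //=; rewrite ?card_unit//.
- by case=> [] [].
- by move=> _ v /eqP ->.
- by move=> v; apply: avg_le => // _; case: eqP.
- by move=> _; rewrite big_unit.
Qed.

Lemma fam_layout l : layout (fam l) (famU l) (famZ l)%:R^-1.
Proof.
elim: l => [|l IH]; first by rewrite invr1; apply: base_layout.
rewrite /= natrM invfM; have := step_layout (arity_gt0 l) H_gt1 IH.
by rewrite card_prod card_ord.
Qed.

(** The slack doubles at each level inwards, so [H] has to serve the innermost value
    [2 ^+ l * kappa]. *)
Lemma fam_sound l (kappa : R) : 0 < kappa -> (2 ^+ l * kappa) ^+ 2 < H%:R ->
  sound (fam l) (famU l) kappa.
Proof.
elim: l kappa => [|l IH] kappa k0 kH.
  exists (fun=> [::]) => -[] [] _; exists 1%N, 1%N; split => //; first by exists 1%N.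
  by move=> v /= /eqP ->.
apply: (step_sound (arity_gt0 l) H_gt1 (fam_layout l)) => //.
  apply: le_lt_trans kH; rewrite exprMn ler_peMl ?sqr_ge0//.
  by rewrite -exprM exprn_ege1// ler1n.
by apply: IH; [rewrite mulr_gt0|rewrite mulrA -exprSr].
Qed.

Lemma card_fam l : #|qry (fam l)| = (Q ^ (l * 2 ^ l.+2))%N.
Proof.
elim: l => [|l IH]; first by rewrite card_unit.
rewrite /= !card_prod card_ord IH /arity -!expnD; congr (Q ^ _)%N.
rewrite [(2 ^ l.+3)%N]expnS; lia.
Qed.

(** With [famZ l] roots per block, the cells allowed by [fam_bounded] amount to [Q] times the number
    of queries per block. *)
Lemma famZ_card l : (famZ l * Q ^ (2 ^ l.+2 - 4))%N = #|qry (fam l)|.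
Proof.
elim: l => [|l IH]; first by rewrite card_unit.
have e : (2 ^ l.+3 - 4 = (2 ^ l.+2 - 4) + 2 ^ l.+2)%N.
  have : (4 <= 2 ^ l.+2)%N by rewrite -[4%N]/(2 ^ 2)%N leq_exp2l.
  rewrite [(2 ^ l.+3)%N]expnS; lia.
rewrite e expnD -/(arity l) /= !card_prod card_ord -IH.
by move: (famZ l) (arity l) (Q ^ _)%N => a b c; lia.
Qed.

Lemma famZ_gt0 l : (0 < famZ l)%N.
Proof. by have := famZ_card l; case: (famZ l) => // /esym; rewrite mul0n card_fam; have := Q_gt0;
  case: (Q) => // q _ /eqP; rewrite expn_eq0. Qed.

(** Measures how much the gaps stretch the line: by [(8 * H) ^ 2 ^ l / (4 * H)] over the number of
    queries, since each level squares the stretch. *)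
Lemma famU_card l : (4 * H * famU l)%N = ((8 * H) ^ 2 ^ l * #|qry (fam l)|)%N.
Proof.
elim: l => [|l IH]; first by rewrite card_unit /= expn1; lia.
rewrite /= /stride /cwidth !card_prod card_ord expnSr expnM.
have -> : (4 * H * (arity l * (2 * famU l) * (H * (arity l * (2 * famU l)))) =
  (4 * H * famU l * arity l) ^ 2)%N by rewrite -mulnn; lia.
by rewrite IH -!mulnn; lia.
Qed.

Variables (S w : nat) (eta : R).
Hypotheses (S_gt0 : (0 < S)%N) (eta_gt0 : 0 < eta) (eta_le : eta <= 2^-1).
Hypothesis Q_ge : (2 * w + 1)%:R <= eta ^+ 2 * Q%:R.

Lemma fam_bounded l :
  bounded S w eta (fam l) (Q ^ (2 ^ l.+2 - 3))%:R ((3 / 4) ^+ l) (4 * l%:R * eta).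
Proof.
elim: l => [|l IH].
  move=> I B J pub mem c tr _ _ c0 c1; rewrite expr0 mul1r mulr0 !mul0r addr0.
  apply: ler_avg => D; apply: ler_sum => i _.
  rewrite /= big_unit mul1r /avg card_unit invr1 mul1r big_unit.
  by apply: ler_sum => r _; rewrite ler_piMr ?score_le1.
have QR : 1 <= Q%:R :> R by rewrite ler1n.
have p4 : (4 <= 2 ^ l.+2)%N by rewrite -[4%N]/(2 ^ 2)%N leq_exp2l.
have p3 : (2 ^ l.+3 = 2 ^ l.+2 + 2 ^ l.+2)%N by rewrite [(2 ^ l.+3)%N]expnS; lia.
have eQ : 1 <= eta ^+ 2 * Q%:R by apply: le_trans Q_ge; rewrite ler1n addn1.
(* One factor [Q] below [arity l], which pays for [2 * w + 1] over [eta ^+ 2]. Also [theta ^ 2] is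
   [Q] times the new number of cells per root, and [eta ^+ 2 * Q >= 1]. *)
pose theta := (Q ^ (2 ^ l.+2 - 1))%N.
have th1 : 1 <= theta%:R :> R by rewrite ler1n expn_gt0 Q_gt0.
have lay := fam_layout l.
have ge0 : 0 <= 3 / 4 :> R by rewrite divr_ge0.
have le1 : 3 / 4 <= 1 :> R by lra.
have -> : 4 * l.+1%:R * eta = 4 * l%:R * eta + 4 * eta by rewrite -natr1; ring.
rewrite exprS /=.
apply: (@bounded_step R S w eta (arity l) theta (fam l) S_gt0 (arity_gt0 l) _ eta_gt0 eta_le
  (qry_card lay) (kernel_ge0 lay) _ _ _ (Q ^ (2 ^ l.+2 - 3))%:R) => //.
- by rewrite expn_gt0 Q_gt0.
- by move=> y; rewrite (kernel_sum lay).
- exact: exprn_ile1.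
- rewrite -natrM /arity -expnD ler_nat p3; apply: leq_pexp2l => //; lia.
- rewrite -natrX -expnM.
  have -> : ((2 ^ l.+2 - 1) * 2 = (2 ^ l.+3 - 3) + 1)%N by lia.
  by rewrite expnD expn1 natrM mulrCA ler_peMr.
- have -> : (arity l)%:R = theta%:R * Q%:R :> R.
    by rewrite -natrM -expnSr subn1 prednK// expn_gt0.
  rewrite mulrCA; apply: (@le_trans _ _ (theta%:R * (2 * w + 1)%:R)).
    have e1 : eta ^+ 2 <= 1.
      by rewrite exprn_ile1 ?(ltW eta_gt0)//; apply: le_trans eta_le _; rewrite invf_le1 ?ler1n.
    rewrite !natrM natrD natrM; nra.
  by apply: ler_wpM2l.
Qed.

(** With at most [T] probes, a correct answer scores at least [2 ^- T]. *)
Lemma fam_success l (I : finType) (T : nat)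
    (mem : {ffun I -> inp (fam l)} -> memory S w)
    (tr : I -> qry (fam l) -> probe_tree S w (seq bool)) :
  S%:R <= (Q ^ (2 ^ l.+2 - 3))%:R * #|I|%:R :> R ->
  (forall D i x, (nprobes (mem D) (tr i x) <= T)%N) ->
  avg (fun D : {ffun I -> inp (fam l)} => \sum_i \sum_x ker (D i) x *
    (run (mem D) (tr i x) == pth (D i) x)%:R) <=
  2 ^+ T * ((3 / 4) ^+ l + 4 * l%:R * eta) * #|I|%:R.
Proof.
move=> S_le hT; have lay := fam_layout l.
have I0 : 0 <= #|I|%:R :> R by rewrite ler0n.
have e0 : ln #|{: unit}|%:R <= eta ^+ 2 * #|I|%:R.
  by rewrite card_unit ln1 mulr_ge0 ?sqr_ge0.
have := @fam_bounded l I unit unit (fun=> tt) mem (fun _ _ _ _ => 1)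
  (fun _ i x _ => tr i x) S_le e0 (fun _ _ _ _ => ler01).
have -> : \sum_(r : unit) (1 : R) = 1 by rewrite sumr_const card_unit.
move=> /(_ (fun _ _ _ => lexx _)) h.
apply: (@le_trans _ _ (2 ^+ T * ((3 / 4) ^+ l * #|I|%:R + 4 * l%:R * eta * #|I|%:R))); last first.
  by rewrite -mulrDl mulrA.
have {h} := ler_wpM2l (exprn_ge0 T (ler0n R 2)) h; rewrite mulrDr => h.
rewrite mulrDr; apply: le_trans (le_trans h _).
  rewrite -avgZl; apply: ler_avg => D; rewrite mulr_sumr; apply: ler_sum => i _.
  rewrite mulr_sumr; apply: ler_sum => x _.
  rewrite mulrCA; apply: ler_wpM2l; first exact: (kernel_ge0 lay).
  rewrite big_unit mul1r /score mulrCA.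
  rewrite ler_peMr// exprVn ler_pdivlMr ?exprn_gt0// mul1r.
  by rewrite ler_eXn2l ?hT// ltr1n.
rewrite lerD2r; apply: ler_wpM2l; first exact: exprn_ge0.
apply: ler_wpM2l; first by rewrite exprn_ge0// divr_ge0.
apply: avg_le => // D; rewrite -sumr_const; apply: ler_sum => i _.
by apply: avg_le => // x; rewrite sumr_const card_unit.
Qed.

End Family.

(** * Embedding into coloured paths *)

Section PathGraph.
Variable n : nat.
Local Notation e := (@path_graph n).

Lemma dist_walk (p : seq 'I_n) (x : 'I_n) : path e x p -> (dist x (last x p) <= size p)%N.
Proof.
elim: p x => [|y p IH] x /=; first by rewrite /dist; lia.
by rewrite {1}/path_graph => /andP[/orP[]/eqP xy /IH]; rewrite /dist; lia.
Qed.

Lemma walk_dist (d : nat) (x y : 'I_n) : dist x y = d -> has_walk e d x y.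
Proof.
elim: d x => [|d IH] x xy.
  have -> : x = y by apply: ord_inj; move: xy; rewrite /dist; lia.
  by apply/existsP; exists [tuple]; rewrite /= eqxx.
have [z xz zy] : exists2 z : 'I_n, e x z & dist z y = d.
  have [lt|le] := ltnP x y.
    have zn : (x.+1 < n)%N by apply: leq_ltn_trans lt (ltn_ord y).
    by exists (Ordinal zn); [rewrite /path_graph eqxx|move: xy; rewrite /dist /=; lia].
  have zn : (x.-1 < n)%N by apply: leq_ltn_trans (leq_pred x) (ltn_ord x).
  have x0 : (0 < x)%N by move: xy; rewrite /dist; lia.
  exists (Ordinal zn); last by move: xy; rewrite /dist /=; lia.
  by rewrite /path_graph /= prednK// eqxx orbT.
have /existsP[p /andP[pp lp]] := IH z zy.
by apply/existsP; exists [tuple of z :: p]; rewrite /= xz pp lp.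
Qed.

Lemma gdistE (x y : 'I_n) : gdist e x y = dist x y.
Proof.
set P := fun l => has_walk e l x y.
have dn : (dist x y < n)%N by have := ltn_ord x; have := ltn_ord y; rewrite /dist; lia.
have Pd : P (dist x y) by apply: walk_dist.
rewrite /gdist card_ord -/P; apply/eqP; rewrite eqn_leq; apply/andP; split.
  rewrite leqNgt; apply/negP => /(before_find 0%N).
  by rewrite nth_iota// add0n Pd.
have hP : has P (iota 0 n) by apply/hasP; exists (dist x y); rewrite // mem_iota.
have := nth_find 0%N hP; have := hP; rewrite has_find size_iota => fn.
rewrite nth_iota// add0n => /existsP[p /andP[pp /eqP lp]].
by have := dist_walk pp; rewrite lp size_tuple.
Qed.

Variables (C : eqType) (col : 'I_n -> C).

Lemma bigminn_le (r : seq 'I_n) (P : pred 'I_n) (F : 'I_n -> nat) m u :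
  u \in r -> P u -> (\big[minn/m]_(i <- r | P i) F i <= F u)%N.
Proof.
elim: r => // a r IH; rewrite inE big_cons => /orP[/eqP <-|/IH{}IH] Pu;
  first by rewrite Pu geq_minl.
by case: ifP => _; rewrite ?IH// (leq_trans (geq_minr _ _))// IH.
Qed.

Lemma cdist_le (v : 'I_n) c u : col u == c -> (cdist e col v c <= dist v u)%N.
Proof. by move=> cu; rewrite -gdistE; apply: bigminn_le; rewrite ?mem_index_enum. Qed.

Lemma cdist_ge (v : 'I_n) c m : (exists u, col u = c) ->
  (forall u, col u == c -> (m <= dist v u)%N) -> (m <= cdist e col v c)%N.
Proof.
move=> [u cu] h; rewrite /cdist; elim/big_ind: _ => [|x y|w cw].
(* The default [n] of the minimum: a vertex [u] of colour [c] exists, and its distance is below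
   [n]. *)
- apply: (leq_trans (h u _)); first exact/eqP.
  by rewrite card_ord; have := ltn_ord v; have := ltn_ord u; rewrite /dist; lia.
- by move=> *; rewrite leq_min; apply/andP.
- by rewrite gdistE h.
Qed.

End PathGraph.

Section Colouring.
Variables (R : realType) (P : problem R) (U : nat) (pi : R).
Hypothesis lay : layout P U pi.
Variables (n sigma Gc nb Wd : nat).
Hypotheses (Gc_lt : (Gc < sigma)%N) (Wd_gt0 : (0 < Wd)%N).
Local Notation BL := (2 * U * (2 * Wd))%N.
Hypothesis fits : (nb * BL <= n)%N.
Local Notation I := ('I_Gc * 'I_nb)%type.

(** [ltn_ord c] reads [c.+1 <= Gc], so this is colour [c.+1], and colour 0 is left for [filler]. *)
Definition active (c : 'I_Gc) : 'I_sigma := Ordinal (leq_ltn_trans (ltn_ord c) Gc_lt).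
Definition filler : 'I_sigma := Ordinal (leq_ltn_trans (leq0n Gc) Gc_lt).

Lemma active_inj : injective active.
Proof. by move=> c c' /(congr1 val) /= [] /ord_inj. Qed.

Lemma active_filler c : active c != filler.
Proof. by apply/eqP => /(congr1 val). Qed.

Definition occupants (D : {ffun I -> inp P}) j p : {set 'I_Gc} := [set c | elt (D (c, j)) p]%SET.

Definition good (D : {ffun I -> inp P}) : bool :=
  [forall j : 'I_nb, forall p : 'I_U, #|occupants D j p| <= Wd]%N.

Definition occupant (D : {ffun I -> inp P}) (j : 'I_nb) (p slot : nat) : option 'I_Gc :=
  [pick c in occupants D j p | index c (enum (occupants D j p)) == slot].

(* A block has [2 * U] positions, each stretched to [2 * Wd] vertices of which the first [Wd]
   are available for the colours with an element at this position. *)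
Definition colour (D : {ffun I -> inp P}) : {ffun 'I_n -> 'I_sigma} :=
  [ffun v : 'I_n =>
    if insub (v %/ BL)%N is Some j then
      if occupant D j (v %% BL %/ (2 * Wd))%N (v %% (2 * Wd))%N is Some c then active c else filler
    else filler].

Lemma width_gt0 : (0 < U)%N.
Proof. exact: (U_gt0 lay). Qed.

Lemma BL_gt0 : (0 < BL)%N.
Proof. by rewrite !muln_gt0 Wd_gt0 width_gt0. Qed.

Lemma colourP D (v : 'I_n) c : good D -> colour D v = active c ->
  exists j : 'I_nb, exists p slot : nat,
    [/\ elt (D (c, j)) p, (slot < Wd)%N & v = (j * BL + (p * (2 * Wd) + slot))%N :> nat].
Proof.
move=> /forallP gD; rewrite ffunE; case: insubP => [j _ vj|_ /esym/eqP];
  last by rewrite (negbTE (active_filler c)).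
rewrite /occupant; case: pickP => [c' /andP[]|_ /esym/eqP];
  last by rewrite (negbTE (active_filler c)).
rewrite inE => el /eqP ix /active_inj cc; rewrite {}cc in el ix.
exists j, (v %% BL %/ (2 * Wd))%N, (v %% (2 * Wd))%N; split => //.
  have := gD j => /forallP /(_ (Ordinal (elt_lt lay el))) /=; apply: leq_trans.
  by rewrite -ix cardE index_mem mem_enum inE.
rewrite vj {1}(divn_eq v BL); congr (_ + _)%N.
have -> : (v %% (2 * Wd) = v %% BL %% (2 * Wd))%N by rewrite modn_dvdm// dvdn_mull.
exact: divn_eq.
Qed.

Lemma pos_lt (j : 'I_nb) p slot : (p < U)%N -> (slot < 2 * Wd)%N ->
  (j * BL + (p * (2 * Wd) + slot) < n)%N.
Proof.
move=> pU sW; apply: leq_trans fits; apply: (@leq_trans (j.+1 * BL));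
  last by rewrite leq_mul2r ltn_ord orbT.
rewrite (mulSn j) addnC ltn_add2r.
have : (p.+1 * (2 * Wd) <= U * (2 * Wd))%N by rewrite leq_mul2r pU orbT.
rewrite (mulSn p) -mulnA; move: (p * (2 * Wd))%N (U * (2 * Wd))%N => a b; lia.
Qed.

Lemma colourI D c (j : 'I_nb) p : good D -> elt (D (c, j)) p ->
  exists v : 'I_n, exists slot, [/\ colour D v = active c, (slot < Wd)%N &
    v = (j * BL + (p * (2 * Wd) + slot))%N :> nat].
Proof.
move=> /forallP gD el; have pU := elt_lt lay el.
pose slot := index c (enum (occupants D j p)).
have sW : (slot < Wd)%N.
  have := gD j => /forallP /(_ (Ordinal pU)) /=; apply: leq_trans.
  by rewrite /slot cardE index_mem mem_enum inE.
have sW2 : (slot < 2 * Wd)%N by lia.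
exists (Ordinal (pos_lt j pU sW2)), slot; split => //.
rewrite ffunE /=.
have lt : (p * (2 * Wd) + slot < BL)%N.
  have : (p.+1 * (2 * Wd) <= U * (2 * Wd))%N by rewrite leq_mul2r pU orbT.
  by rewrite (mulSn p) -mulnA; move: (p * (2 * Wd))%N (U * (2 * Wd))%N => a b; lia.
have -> : ((j * BL + (p * (2 * Wd) + slot)) %% (2 * Wd) = slot)%N.
  by rewrite mulnA addnA -mulnDl modnMDl modn_small.
rewrite divnMDl ?BL_gt0// divn_small// addn0 modnMDl modn_small// divnMDl ?muln_gt0//.
rewrite [(slot %/ _)%N]divn_small// addn0.
case: insubP => [j' _ jj|]; last by rewrite ltn_ord.
rewrite (ord_inj jj) /occupant; case: pickP => [c' /andP[c'in /eqP ix]|].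
  congr active; rewrite -[c'](nth_index c (_ : c' \in enum (occupants D j p))) ?mem_enum// ix.
  by rewrite nth_index// mem_enum inE.
by move=> /(_ c); rewrite inE el eqxx.
Qed.

Lemma double_gt0 : (0 < 2 * Wd)%N.
Proof. by rewrite muln_gt0. Qed.

Definition qvertex (i : I) (x : qry P) : 'I_n :=
  Ordinal (pos_lt i.2 (qpos_lt lay x) double_gt0).

(** Stretching by [2 * Wd] with slots below [Wd] turns a distance [d] into one between
    [(2 * d - 1) * Wd] and [(2 * d + 1) * Wd], and [d] is positive. Other blocks are out of reach,
    as the second half of each block is empty. *)
Lemma colour_dist D i x lo hi : good D -> (0 < lo)%N -> (hi <= U)%N ->
  (exists2 p, elt (D i) p & (dist p (qpos x) <= hi)%N) ->
  (forall p, elt (D i) p -> (lo <= dist p (qpos x))%N) ->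
  (exists2 u, colour D u = active i.1 & (dist (qvertex i x) u <= 3 * hi * Wd)%N) /\
  (forall u, colour D u = active i.1 -> (lo * Wd <= dist (qvertex i x) u)%N).
Proof.
case: i => c j gD lo0 hiU [p0 elp0 dp0] low.
have lohi : (lo <= hi)%N by apply: leq_trans dp0; apply: low.
have scale p q slot : (slot < Wd)%N ->
    (dist p q * (2 * Wd) - Wd <= dist (j * BL + (q * (2 * Wd) + 0)) (j * BL + (p * (2 * Wd) + slot))
      <= dist p q * (2 * Wd) + Wd)%N.
  move=> sW; rewrite /dist; have [pq|pq] := leqP p q.
    rewrite -(subnKC pq); move: (q - p)%N => d.
    have -> : (p - (p + d) + (p + d - p) = d)%N by lia.
    by rewrite mulnDl; move: (j * BL)%N (p * _)%N (d * _)%N => x1 x2 x3; lia.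
  rewrite -(subnKC (ltnW pq)); move: (p - q)%N => d.
  have -> : (q + d - q + (q - (q + d)) = d)%N by lia.
  by rewrite mulnDl; move: (j * BL)%N (q * _)%N (d * _)%N => x1 x2 x3; lia.
split.
  have [v [slot [cv sW ev]]] := colourI gD elp0.
  exists v => //; rewrite /= ev; have /andP[_ h] := scale p0 (qpos x) slot sW.
  apply: (leq_trans h); move: dp0; move: (dist p0 _) => d dp0.
  have : (d * (2 * Wd) <= hi * (2 * Wd))%N by rewrite leq_mul2r dp0 orbT.
  have : (Wd <= hi * Wd)%N by rewrite leq_pmull//; lia.
  by rewrite mulnCA -mulnA; lia.
move=> u /(colourP gD)[j' [p [slot [el sW eu]]]]; rewrite /= eu.
have [jj|jj] := eqVneq j' j.
  rewrite jj in el *; have /andP[h _] := scale p (qpos x) slot sW.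
  apply: leq_trans h; have d := low p el; move: (dist p _) d => d d'.
  have : (lo * (2 * Wd) <= d * (2 * Wd))%N by rewrite leq_mul2r d' orbT.
  have : (Wd <= lo * Wd)%N by rewrite leq_pmull.
  by rewrite mulnCA; lia.
have pU : (p.+1 * (2 * Wd) <= U * (2 * Wd))%N by rewrite leq_mul2r (elt_lt lay el) orbT.
have qU : ((qpos x).+1 * (2 * Wd) <= U * (2 * Wd))%N by rewrite leq_mul2r (qpos_lt lay x) orbT.
have lU : (lo * Wd <= U * (2 * Wd))%N by apply: leq_mul; lia.
have {jj} : (j' : nat) != j by apply: contraNneq jj => /ord_inj ->.
rewrite (mulSn p) in pU; rewrite (mulSn (qpos x)) in qU.
rewrite -mulnA; move: (U * (2 * Wd))%N pU qU lU => W pU qU lU.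
move: (p * (2 * Wd))%N (qpos x * (2 * Wd))%N (lo * Wd)%N pU qU lU => A B C pU qU lU.
rewrite neq_ltn => /orP[] lt.
  have : (j'.+1 * (2 * W) <= j * (2 * W))%N by rewrite leq_mul2r lt orbT.
  by rewrite (mulSn j') /dist; move: (j' * (2 * W))%N (j * (2 * W))%N => x1 x2; lia.
have : (j.+1 * (2 * W) <= j' * (2 * W))%N by rewrite leq_mul2r lt orbT.
by rewrite (mulSn j) /dist; move: (j' * (2 * W))%N (j * (2 * W))%N => x1 x2; lia.
Qed.

Lemma expR1_le4 : expR 1 <= 4 :> R.
Proof.
have h : expR 2^-1 <= 2 :> R.
  rewrite -[leLHS]invrK -expRN -[leRHS]invrK lef_pV2 ?posrE ?expR_gt0//.
  apply: le_trans (expR_ge1Dx _); lra.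
have -> : (1 : R) = 2^-1 + 2^-1 by lra.
rewrite expRD; apply: (@le_trans _ _ (2 * 2)); last by lra.
by apply: ler_pM; rewrite ?expR_ge0.
Qed.

(** Markov's inequality for 2 to the number of occupants of a position, whose mean is at most
    [(1 + pi) ^ Gc <= expR 1 <= 4], followed by a union bound over the positions. *)
Lemma avg_bad : Gc%:R * pi <= 1 ->
  avg (fun D => (~~ good D)%:R) <= (nb * U)%:R * (4 / 2 ^+ Wd) :> R.
Proof.
move=> Gpi; have pi0 : 0 <= pi by apply: le_trans (elt_avg lay 0%N); apply: avg_ge0.
have one (j : 'I_nb) p : avg (fun D => (Wd < #|occupants D j p|)%N%:R) <= 4 / 2 ^+ Wd :> R.
  rewrite ler_pdivlMr ?exprn_gt0// -avgZr.
  pose F (i : I) (y : inp P) : R := if i.2 == j then 1 + (elt y p)%:R else 1.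
  apply: (@le_trans _ _ (avg (fun D : {ffun I -> inp P} => \prod_i F i (D i)))).
    apply: ler_avg => D.
    have -> : \prod_i F i (D i) = 2 ^+ #|occupants D j p|.
      rewrite prod_pairE.
      rewrite -prodr_const [RHS]big_mkcond; apply: eq_bigr => c _.
      rewrite (bigD1 j)//= /F eqxx big1 ?mulr1 => [|j' /negbTE /= ->//].
      by rewrite inE; case: elt; rewrite ?addr0.
    case: ltnP => lt; rewrite ?mul1r ?mul0r ?exprn_ge0//.
    by rewrite ler_eXn2l ?ltr1n// ltnW.
  rewrite avg_ffun_prod; apply: (le_trans _ expR1_le4).
  apply: (@le_trans _ _ (\prod_(i : I) if i.2 == j then expR pi else 1)).
    apply: ler_prod => i _; rewrite /F; case: eqP => _; last first.
      by rewrite avg_const ?(inp_card lay)// ler01 lexx.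
    rewrite avg_ge0 => [/=|y]; last by rewrite addr_ge0.
    rewrite avgD avg_const ?(inp_card lay)//; apply: le_trans (expR_ge1Dx _).
    by rewrite lerD2l (elt_avg lay).
  rewrite prod_pairE /=.
  under eq_bigr => c _ do rewrite -big_mkcond big_pred1_eq.
  rewrite prodr_const card_ord -expRM_natl ler_expR//.
apply: (@le_trans _ _ (avg (fun D => \sum_(jp : 'I_nb * 'I_U)
  (Wd < #|occupants D jp.1 jp.2|)%N%:R))).
  apply: ler_avg => D; have [_|] := boolP (good D); first by apply: sumr_ge0.
  case/forallPn => j /forallPn[p]; rewrite -ltnNge => lt.
  by rewrite (bigD1 (j, p))//= lt lerDl sumr_ge0.
rewrite avg_sum; apply: (@le_trans _ _ (\sum_(jp : 'I_nb * 'I_U) 4 / 2 ^+ Wd)).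
  by apply: ler_sum => jp _; apply: one.
by rewrite sumr_const card_prod !card_ord -[_ *+ _]mulr_natl.
Qed.

End Colouring.

(** Yao's principle: integrating over [Omega] carries a bound on the weighted success of every fixed
    outcome over to the guaranteed probability [p]. *)
Lemma measure_weighted_le (R : realType) (d : measure_display) (Omega : measurableType d)
    (P : probability Omega R) (J : finType) (a : J -> R) (A : J -> set Omega) (p b : R) :
  (forall j, 0 <= a j) ->
  (forall j, measurable (A j) /\ (p%:E <= P (A j))%E) ->
  (forall om, \sum_j a j * (`[< A j om >])%:R <= b) ->
  p * \sum_j a j <= b.
Proof.
move=> a0 AP Ab.
rewrite -lee_fin.
have -> : b%:E = (\int[P]_(x in [set: Omega]) b%:E)%E.
  by rewrite integral_cst// [X in (_ * X)%E]probability_setT mule1.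
apply: (@le_trans _ _ (\int[P]_(x in [set: Omega]) (\sum_j (a j)%:E * (\1_(A j) x)%:E))%E).
  rewrite ge0_integral_sum//; last 2 first.
  - move=> j; apply/measurable_EFinP; apply: measurable_funM => //.
    by apply: measurable_indic; case: (AP j).
  - by move=> j x _; rewrite mule_ge0 ?lee_fin.
  rewrite mulr_sumr -sumEFin; apply: lee_sum => j _.
  have [mA pA] := AP j.
  rewrite ge0_integralZl ?lee_fin//; last first.
    by apply/measurable_EFinP; apply: measurable_indic.
  rewrite integral_indic// setIT mulrC EFinM.
  by apply: lee_wpmul2l => //; rewrite lee_fin.
apply: ge0_le_integral => //.
- by move=> x _; apply: sume_ge0 => j _; rewrite mule_ge0 ?lee_fin.
- apply: emeasurable_sum => j; apply: measurable_funeM.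
  by apply/measurable_EFinP; apply: measurable_indic; case: (AP j).
- move=> x _; apply: (@le_trans _ _ (\sum_j a j * (`[< A j x >])%:R)%:E); last by rewrite lee_fin.
  rewrite -sumEFin; apply: lee_sum => j _.
  by rewrite EFinM indicE.
Qed.

(** * Success probability on random coloured paths *)

Section PathSuccess.
Variables (R : realType) (Q H L : nat) (S w : nat) (eta kappa k : R).
Hypotheses (Q_gt0 : (0 < Q)%N) (H_gt1 : (1 < H)%N).
Hypotheses (S_gt0 : (0 < S)%N) (eta_gt0 : 0 < eta) (eta_le : eta <= 2^-1).
Hypothesis Q_ge : (2 * w + 1)%:R <= eta ^+ 2 * Q%:R.
Hypotheses (kappa_ge1 : 1 <= kappa) (k_le : 3 * k <= kappa).
Hypothesis H_ge : (2 ^+ L * kappa) ^+ 2 < H%:R.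
Variables (n sigma nb Wd : nat).
Local Notation P := (fam R Q H L).
Local Notation U := (famU Q H L).
Local Notation Gc := (famZ R Q H L).
Hypotheses (Gc_lt : (Gc < sigma)%N) (Wd_gt0 : (0 < Wd)%N) (nb_gt0 : (0 < nb)%N).
Hypothesis fits : (nb * (2 * U * (2 * Wd)) <= n)%N.
Hypothesis S_le : S%:R <= (Q ^ (2 ^ L.+2 - 3))%:R * (Gc * nb)%:R :> R.
Let lay := fam_layout R Q_gt0 H_gt1 L.
Local Notation I := ('I_Gc * 'I_nb)%type.
Local Notation bnd T := (2 ^+ T * ((3 / 4) ^+ L + 4 * L%:R * eta) + (nb * U)%:R * (4 / 2 ^+ Wd)).

Definition question (i : I) (x : qry P) : 'I_n * 'I_sigma :=
  (qvertex lay Gc_lt Wd_gt0 fits i x, active Gc_lt i.1).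

Definition colouring (D : {ffun I -> inp P}) : {ffun 'I_n -> 'I_sigma} :=
  colour U n Wd Gc_lt D.

(** The distortion 3 of [colour_dist] and the factor [k] together fit into [kappa], once the
    estimate is divided by the stretch [Wd]. *)
Lemma approx_decode : exists dec : R -> seq bool, forall D i x est,
  good U Wd D -> ker (D i) x != 0 -> approx_ok k (colouring D) (question i x) est ->
  dec est = pth (D i) x.
Proof.
have k0 : 0 < kappa := lt_le_trans ltr01 kappa_ge1.
have [dec decP] := fam_sound Q_gt0 H_gt1 k0 H_ge.
exists (fun est => dec (est / Wd%:R)) => D i x est gD kx.
have [lo [hi [lo0 hiU ex low dP]]] := decP _ _ kx.
have [[u cu du] lowu] := colour_dist lay Gc_lt Wd_gt0 fits gD lo0 hiU ex low.
move=> /(_ (ex_intro _ u cu)) /=; set dd := cdist _ _ _ _ => /andP[e1 e2].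
have WR : 0 < Wd%:R :> R by rewrite ltr0n.
have d1 : (dd <= 3 * hi * Wd)%N.
  by apply: leq_trans du; apply: cdist_le; apply/eqP.
have d2 : (lo * Wd <= dd)%N.
  by apply: cdist_ge => [|u' /eqP /lowu//]; exists u.
have {}d1 : dd%:R <= 3 * hi%:R * Wd%:R :> R by rewrite -!natrM ler_nat.
have {}d2 : lo%:R * Wd%:R <= dd%:R :> R by rewrite -natrM ler_nat.
apply: dP; apply/andP; split.
  rewrite ler_pdivlMr//; apply: le_trans e1; apply: le_trans d2.
  by rewrite mulrAC ler_pdivrMr// ler_peMr// mulr_ge0// ltW.
rewrite ler_pdivrMr//; apply: (le_trans e2).
(* The sign of [k] is not given; a negative [k] forces the estimate to be at most 0. *)
have [kneg|kpos] := ltP k 0.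
  apply: (@le_trans _ _ 0); first by rewrite nmulr_rle0.
  by rewrite !mulr_ge0// ltW.
apply: (@le_trans _ _ (k * (3 * hi%:R * Wd%:R))); first exact: ler_wpM2l.
have -> : k * (3 * hi%:R * Wd%:R) = 3 * k * (hi%:R * Wd%:R) by ring.
by rewrite -[leRHS]mulrA; apply: ler_wpM2r => //; rewrite mulr_ge0// ltW.
Qed.

(** Colourings that are not [good] cannot be decoded; they are counted as full successes and charged
    to [avg_bad]. *)
Lemma path_success (T : nat) (prep : {ffun 'I_n -> 'I_sigma} -> memory S w)
    (query : 'I_n * 'I_sigma -> probe_tree S w R) :
  (forall col q, (nprobes (prep col) (query q) <= T)%N) ->
  avg (fun D : {ffun I -> inp P} => \sum_i \sum_x ker (D i) x *
    (`[< approx_ok k (colouring D) (question i x)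
      (run (prep (colouring D)) (query (question i x))) >])%:R) <= bnd T * #|{: I}|%:R.
Proof.
move=> hT; have [dec decP] := approx_decode.
have cI : #|{: I}| = (Gc * nb)%N by rewrite card_prod !card_ord.
have := @fam_success R Q H Q_gt0 H_gt1 S w eta S_gt0 eta_gt0 eta_le Q_ge L I T
  (fun D => prep (colouring D)) (fun i x => map_tree dec (query (question i x))).
rewrite cI => /(_ S_le) h.
rewrite mulrDl; apply: (@le_trans _ _ (_ + avg (fun D : {ffun I -> inp P} => (~~ good U Wd D)%:R) *
  #|{: I}|%:R)); last first.
  rewrite -cI in h *.
  apply: lerD; first by apply: h => D i x; rewrite nprobes_map_tree.
  apply: ler_wpM2r => //; apply: (avg_bad lay).
  by rewrite mulfV// pnatr_eq0 -lt0n famZ_gt0.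
rewrite -avgZr -avgD; apply: ler_avg => D.
have nat_le1 (b : bool) : b%:R <= 1 :> R by case: b.
have [gD|gD] := boolP (good U Wd D); rewrite /= ?mul0r ?addr0 ?mul1r.
  apply: ler_sum => i _; apply: ler_sum => x _.
  have [->|kx] := eqVneq (ker (D i) x) 0; first by rewrite !mul0r.
  rewrite run_map_tree; apply: ler_wpM2l; first exact: (kernel_ge0 lay).
  by case: asboolP => // /(decP _ _ _ _ gD kx) ->; rewrite eqxx.
rewrite -[leLHS]add0r; apply: lerD.
  by apply: sumr_ge0 => i _; apply: sumr_ge0 => x _; rewrite mulr_ge0 ?(kernel_ge0 lay)//.
rewrite -sumr_const; apply: ler_sum => i _; rewrite -[leRHS](kernel_sum lay (D i)).
by apply: ler_sum => x _; rewrite ler_piMr ?(kernel_ge0 lay)//.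
Qed.

Lemma rand_success (d : measure_display) (Omega : measurableType d) (Pr : probability Omega R)
    (delta : R) (T : nat)
    (D : rand_ds {ffun 'I_n -> 'I_sigma} ('I_n * 'I_sigma) R Omega S w) :
  rand_solves (@approx_ok R n sigma k) Pr delta D -> rand_time_le D T ->
  1 - delta <= bnd T.
Proof.
move=> sol tim.
pose J : finType := ({ffun I -> inp P} * (I * qry P))%type.
pose a (j : J) : R := #|{: {ffun I -> inp P}}|%:R^-1 * ker (j.1 j.2.1) j.2.2.
pose A (j : J) : set Omega := [set om | approx_ok k (colouring j.1) (question j.2.1 j.2.2)
  (run (rand_prep D (colouring j.1)) (rand_query D om (question j.2.1 j.2.2)))]%classic.
have sumJ (F : J -> R) : \sum_j a j * F j =
    avg (fun E : {ffun I -> inp P} => \sum_i \sum_x ker (E i) x * F (E, (i, x))).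
  rewrite sum_pairE /avg mulr_sumr; apply: eq_bigr => E _.
  rewrite sum_pairE mulr_sumr; apply: eq_bigr => i _; rewrite mulr_sumr.
  by apply: eq_bigr => x _; rewrite /a mulrA.
have I0 : 0 < #|{: I}|%:R :> R by rewrite ltr0n card_prod !card_ord muln_gt0 famZ_gt0.
have sa : \sum_j a j = #|{: I}|%:R.
  under eq_bigr => j _ do rewrite -[a j]mulr1.
  rewrite (sumJ (fun=> 1)) -[RHS](@avg_const R {ffun I -> inp P}).
    apply: eq_avg => E; rewrite -sumr_const; apply: eq_bigr => i _.
    by under eq_bigr => x _ do rewrite mulr1; rewrite (kernel_sum lay).
  by rewrite card_ffun expn_gt0 (inp_card lay).
rewrite -(ler_pM2r I0) -sa; apply: (measure_weighted_le (P := Pr) (A := A)).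
- by move=> j; rewrite mulr_ge0 ?invr_ge0 ?(kernel_ge0 lay)//.
- by move=> j; apply: sol.
move=> om; rewrite sa sumJ; apply: (path_success (prep := rand_prep D) (query := rand_query D om)).
by move=> col q; apply: tim.
Qed.

End PathSuccess.

(** * Queries without probes *)

Section ZeroProbes.
Variables (R : realType) (n sigma S w : nat) (k : R).
Hypotheses (n_gt1 : (1 < n)%N) (sigma_gt1 : (1 < sigma)%N).

Lemma run_no_probe A (t : probe_tree S w A) (m m' : memory S w) :
  nprobes m t = 0%N -> run m t = run m' t.
Proof. by case: t. Qed.

(** Without probes the answer is the same for both colourings, but [near] forces an estimate of at
    most 0 and [far] one of at least 1. The two events of correctness are disjoint, and each has
    probability above [1 / 2]. *)
Lemma zero_probes_fail (d : measure_display) (Omega : measurableType d)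
    (P : probability Omega R) (delta : R)
    (D : rand_ds {ffun 'I_n -> 'I_sigma} ('I_n * 'I_sigma) R Omega S w) :
  delta < 2^-1 -> rand_solves (@approx_ok R n sigma k) P delta D ->
  ~ rand_time_le D 0.
Proof.
move=> d2 sol tim.
pose v0 : 'I_n := Ordinal (ltnW n_gt1); pose v1 : 'I_n := Ordinal n_gt1.
pose c0 : 'I_sigma := Ordinal (ltnW sigma_gt1); pose c1 : 'I_sigma := Ordinal sigma_gt1.
pose near : {ffun 'I_n -> 'I_sigma} := [ffun v => if v == v0 then c0 else c1].
pose far : {ffun 'I_n -> 'I_sigma} := [ffun v => if v == v0 then c1 else c0].
have [mA pA] := sol near (v0, c0); have [mB pB] := sol far (v0, c0).
pose ev col : set Omega := [set om | approx_ok k col (v0, c0)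
  (run (rand_prep D col) (rand_query D om (v0, c0)))]%classic.
rewrite -/(ev near) in mA pA; rewrite -/(ev far) in mB pB.
have AB : (ev near `&` ev far = set0)%classic.
  apply/seteqP; split => // om []; rewrite /ev /mkset /approx_ok /=.
  have -> : run (rand_prep D far) (rand_query D om (v0, c0)) =
            run (rand_prep D near) (rand_query D om (v0, c0)).
    apply: run_no_probe; apply/eqP; rewrite -leqn0; exact: tim.
  set est := run _ _.
  have nv : near v0 = c0 by rewrite ffunE eqxx.
  have fv : far v1 = c0 by rewrite ffunE.
  move=> /(_ (ex_intro _ v0 nv)) /andP[_ e1] /(_ (ex_intro _ v1 fv)) /andP[e2 _].
  have d0 : cdist (@path_graph n) near v0 c0 = 0%N.
    apply/eqP; rewrite -leqn0; have := @cdist_le n _ near v0 c0 v0; rewrite nv eqxx => /(_ isT).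
    by rewrite /dist subnn.
  have d1 : (1 <= cdist (@path_graph n) far v0 c0)%N.
    apply: cdist_ge => [|u]; first by exists v1.
    rewrite ffunE; have [_ /eqP e|uv _] := eqVneq u v0; first by have := congr1 val e.
    have : (u : nat) != v0 by apply: contraNneq uv => /ord_inj ->.
    by rewrite /dist /=; lia.
  rewrite d0 mulr0 in e1; have := le_trans e2 e1.
  by rewrite leNgt ltr0n d1.
have : (P (ev near `|` ev far)%classic <= 1)%E by apply: probability_le1; apply: measurableU.
rewrite measureU//.
have h := leeD pA pB; move=> /(le_trans h); rewrite -EFinD lee_fin; lra.
Qed.

End ZeroProbes.

(** On a one-point probability space, a deterministic solution has error 0. *)
Lemma det_solves_rand (R : realType) (I Q A : Type) (ok : I -> Q -> A -> Prop) (S w : nat)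
    (D : det_ds I Q A S w) :
  det_solves ok D ->
  rand_solves ok (@dirac _ unit tt R) 0 (RandDS (det_prep D) (fun _ : unit => det_query D)).
Proof.
move=> sol i q; split => //; rewrite subr0.
rewrite (_ : mkset _ = setT); first by rewrite probability_setT.
by apply/seteqP; split => // om _; apply: sol.
Qed.

(** * Choice of parameters *)

Section Tuning.
Variables (R : realType) (n S w L : nat) (kappa : R).

(** The offset 2 secures both [1 < H] and the strict bound in [fam_sound]. *)
Definition separation : nat := (Num.truncn ((2 ^+ L * kappa) ^+ 2)).+2.
(** Chosen so that [16 * n <= 2 ^ slots], which makes a crowded position occur with probability at
    most [1 / 4]. *)
Definition slots : nat := (trunc_log 2 n + 5)%N.
(* The factors pay for the word size and [eta = 4 ^- L.+1], for [S / n], for the slots of a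
   position, and for the gaps between positions. *)
Definition arity_base : nat :=
  ((2 * w + 1) * (4 ^ L.+1) ^ 2 * (maxn S n %/ n).+1 * (8 * slots) * (8 * separation) ^ 2 ^ L)%N.

Lemma slots_ge : (16 * n <= 2 ^ slots)%N.
Proof.
rewrite /slots -[5%N]/(1 + 4)%N addnA addn1 expnD.
have := @trunc_log_ltn 2 n isT; move: (2 ^ (trunc_log 2 n).+1)%N => y ny.
by rewrite -[(2 ^ 4)%N]/16%N; lia.
Qed.

Lemma leq_3exp m : (m <= 3 ^ m)%N.
Proof.
elim: m => // m IH; rewrite expnS; have : (0 < 3 ^ m)%N by rewrite expn_gt0.
lia.
Qed.

(** The path is cut into as many blocks as fit. The bound on [sigma] makes a block shorter than
    [sigma <= n] and the active colours fewer than [sigma]; the blocks then fill at least half of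
    the path, so there are enough roots for [S]. *)
Lemma probes_ge (sigma T : nat) (k delta : R)
    (d : measure_display) (Omega : measurableType d) (P : probability Omega R)
    (D : rand_ds {ffun 'I_n -> 'I_sigma} ('I_n * 'I_sigma) R Omega S w) :
  (0 < S)%N -> 1 <= kappa -> 3 * k <= kappa -> (sigma <= n)%N ->
  (arity_base ^ (L * 2 ^ L.+2).+1 < sigma)%N ->
  rand_solves (@approx_ok R n sigma k) P delta D -> rand_time_le D T ->
  1 - delta <= 2 ^+ T * (2 * (3 / 4) ^+ L) + 4^-1.
Proof.
move=> S0 kap1 k3 sn bs sol tim.
set H := separation; set Q := arity_base; set Wd := slots.
have n0 : (0 < n)%N by lia.
have H1 : (1 < H)%N by [].
have Wd0 : (0 < Wd)%N by rewrite /Wd /slots addnS.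
have Q0 : (0 < Q)%N by rewrite /Q /arity_base !muln_gt0 !expn_gt0 -/Wd Wd0 addn1 /=.
set E := ((8 * H) ^ 2 ^ L)%N; have E0 : (0 < E)%N by rewrite expn_gt0 muln_gt0 (ltnW H1).
have E8 : (8 * H <= E)%N by rewrite -[leqLHS]expn1 leq_exp2l ?expn_gt0//; lia.
pose eta : R := (4 ^ L.+1)%:R^-1.
have M0 : 0 < (4 ^ L.+1)%:R :> R by rewrite ltr0n expn_gt0.
have eta0 : 0 < eta by rewrite invr_gt0.
have eta2 : eta <= 2^-1.
  rewrite lef_pV2 ?posrE// ler_nat expnS; have : (0 < 4 ^ L)%N by rewrite expn_gt0.
  lia.
have Qge : (2 * w + 1)%:R <= eta ^+ 2 * Q%:R.
  rewrite /eta exprVn mulrC ler_pdivlMr ?exprn_gt0// -natrX -natrM ler_nat.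
  rewrite /Q /arity_base -!mulnA leq_mul2l leq_mul2l; apply/orP; right; apply/orP; right.
  by rewrite leq_pmulr// !muln_gt0 -/Wd Wd0 expn_gt0.
set X := #|qry (fam R Q H L)|.
have XE : X = (Q ^ (L * 2 ^ L.+2))%N by apply: card_fam.
have UE := famU_card R Q0 H1 L; rewrite -/E -/X in UE.
set U := famU Q H L in UE *.
have UX : (U <= E * X)%N by move: UE; move: (E * X)%N => y; nia.
have XU : (X <= U)%N.
  have : (8 * H * X <= 4 * H * U)%N by rewrite UE leq_mul2r E8 orbT.
  nia.
have Gc := famZ_card R Q0 H1 L.
have GcX : (famZ R Q H L <= X)%N by rewrite /X -Gc leq_pmulr// expn_gt0 Q0.
have QX : (Q * X < sigma)%N by rewrite XE -expnS.
have [q Qq q0] : exists2 q, Q = (q * (8 * Wd * E))%N & (0 < q)%N.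
  exists ((2 * w + 1) * (4 ^ L.+1) ^ 2 * (maxn S n %/ n).+1)%N.
    by rewrite /Q /arity_base -/Wd -/H -/E; lia.
  by rewrite !muln_gt0 !expn_gt0 addn1.
set BL := (2 * U * (2 * Wd))%N.
have BLQ : (BL <= Q * X)%N.
  rewrite /BL Qq; apply: (@leq_trans (8 * Wd * E * X)); last by rewrite -[leqRHS]mulnA leq_pmull.
  have : (Wd * U <= Wd * (E * X))%N by rewrite leq_mul2l UX orbT.
  lia.
have BL0 : (0 < BL)%N.
  have : (0 < X)%N by rewrite XE expn_gt0 Q0.
  by rewrite !muln_gt0 Wd0; lia.
have Gcs : (famZ R Q H L < sigma)%N.
  have : (U <= BL)%N by rewrite /BL; nia.
  lia.
pose nb := (n %/ BL)%N.
have nb0 : (0 < nb)%N by rewrite divn_gt0//; lia.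
have fits : (nb * BL <= n)%N := leq_trunc_div n BL.
have Sle : S%:R <= (Q ^ (2 ^ L.+2 - 3))%:R * (famZ R Q H L * nb)%:R :> R.
  rewrite -natrM ler_nat.
  have p4 : (4 <= 2 ^ L.+2)%N by rewrite -[4%N]/(2 ^ 2)%N leq_exp2l.
  have -> : (2 ^ L.+2 - 3 = (2 ^ L.+2 - 4).+1)%N by lia.
  have -> : (Q ^ (2 ^ L.+2 - 4).+1 * (famZ R Q H L * nb) = Q * X * nb)%N.
    by rewrite /X -Gc expnS; lia.
  apply: (@leq_trans ((maxn S n %/ n).+1 * n)).
    by apply: leq_trans (ltnW (ltn_ceil _ n0)); rewrite leq_maxl.
  have nlt : (n <= 2 * (nb * BL))%N.
    have := ltn_ceil n BL0; rewrite -/nb mulSn => lt.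
    have : (BL <= nb * BL)%N by rewrite leq_pmull.
    lia.
  apply: (@leq_trans ((maxn S n %/ n).+1 * (2 * (nb * BL)))); first by rewrite leq_mul2l nlt orbT.
  have -> : (Q * X * nb = (maxn S n %/ n).+1 * ((2 * w + 1) * (4 ^ L.+1) ^ 2 *
    (8 * Wd * (E * X) * nb)))%N.
    by rewrite /Q /arity_base -/Wd -/H -/E; lia.
  rewrite leq_mul2l; apply/orP; right.
  apply: (@leq_trans (8 * Wd * (E * X) * nb)); last first.
    by rewrite leq_pmull// muln_gt0 !expn_gt0 addn1.
  have : (Wd * U * nb <= Wd * (E * X) * nb)%N by rewrite leq_mul2r leq_mul2l UX !orbT.
  by rewrite /BL; lia.
have Hge : (2 ^+ L * kappa) ^+ 2 < H%:R.
  by rewrite /H /separation; apply: lt_trans (truncnS_gt _) _; rewrite ltr_nat.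
apply: (le_trans (rand_success Q0 H1 S0 eta0 eta2 Qge kap1 k3 Hge Gcs Wd0 nb0 fits Sle sol tim)).
apply: lerD.
  rewrite ler_pM2l ?exprn_gt0// [leRHS]mulr_natl mulr2n lerD2l.
  (* The choice of [eta] makes the accumulated loss [4 * L * eta] equal to [L / 4 ^ L], which is at
     most [(3 / 4) ^ L] as [L <= 3 ^ L]. *)
  rewrite /eta expnS natrM invfM exprMn exprVn.
  have -> : 4 * L%:R * (4%:R^-1 * (4 ^ L)%:R^-1) = L%:R / (4 ^ L)%:R :> R.
    by field; rewrite pnatr_eq0 -lt0n expn_gt0.
  rewrite natrX; apply: ler_wpM2r; first by rewrite invr_ge0 exprn_ge0.
  by rewrite -natrX ler_nat leq_3exp.
rewrite mulrA ler_pdivrMr ?exprn_gt0// -natrX ler_pdivlMl// -!natrM ler_nat.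
apply: leq_trans slots_ge.
have : (nb * U <= nb * BL)%N by rewrite leq_mul2l /BL; apply/orP; right; nia.
lia.
Qed.

End Tuning.

(** * Logarithmic estimates *)

Section Numerics.
Variable R : realType.

Lemma ln_le_id (x : R) : 0 < x -> ln x <= x.
Proof.
move=> x0; rewrite -[leRHS]expRK ler_ln ?posrE ?expR_gt0//.
apply: le_trans (expR_ge1Dx x); lra.
Qed.

Lemma ln2_ge : 2^-1 <= ln 2 :> R.
Proof.
have h : ln (2^-1) <= - 2^-1 :> R.
  rewrite -[leRHS]expRK ler_ln ?posrE ?expR_gt0 ?invr_gt0//.
  apply: le_trans (expR_ge1Dx _); lra.
by move: h; rewrite lnV ?posrE// lerN2.
Qed.

Lemma ln2_le1 : ln 2 <= 1 :> R.
Proof.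
rewrite -[leRHS]expRK ler_ln ?posrE ?expR_gt0//.
apply: le_trans (expR_ge1Dx _); lra.
Qed.

(** In 105, a share of 77 comes from the first four factors of [arity_base] and 28 from
    [separation]. *)
Definition growth_const (a wu : R) (b : nat) : R :=
  ln (1 + 2 * `|wu|) + 2 * ln (1 + 3 * `|a|) + 2 * b%:R + 105.

Lemma growth_const_ge1 a wu b : 1 <= growth_const a wu b.
Proof.
have h1 : 0 <= ln (1 + 2 * `|wu|) by rewrite ln_ge0// lerDl mulr_ge0.
have h2 : 0 <= ln (1 + 3 * `|a|) by rewrite ln_ge0// lerDl mulr_ge0.
have h3 : 0 <= b%:R :> R by [].
rewrite /growth_const; lra.
Qed.

(** Apart from the factor for [S / n] and the exponent [2 ^ L] of the last factor, everything is
    polylogarithmic in [n]; for [4 ^ L.+1] and [separation] this uses [L <= ln (ln n)]. *)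
Lemma ln_arity_base_le (a wu : R) (b n S w L : nat) :
  (0 < n)%N -> 1 <= ln (ln n%:R) :> R -> w%:R <= wu * ln n%:R -> L%:R <= ln (ln n%:R) :> R ->
  ln (arity_base n S w L (1 + 3 * `|a| * ln n%:R ^+ b))%:R <=
  2 ^+ L * (ln ((maxn S n)%:R / n%:R) + ln (ln n%:R)) * growth_const a wu b.
Proof.
move=> n0; set l : R := ln n%:R; set y := ln l; set kap := 1 + _ => y1 wl Ly.
have nR : 0 < n%:R :> R by rewrite ltr0n.
have l0 : 0 < l.
  by rewrite ltNge; apply/negP => /ln0 e; rewrite /y e in y1; move: y1; rewrite ler10.
have l1 : 1 <= l by apply: le_trans y1 _; apply: ln_le_id.
have p4 : 0 < (4 ^ L.+1)%N%:R :> R by rewrite ltr0n expn_gt0.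
have f1 : ln (2 * w + 1)%N%:R <= ln (1 + 2 * `|wu|) + y.
  have wp : 0 < 1 + 2 * `|wu| by rewrite ltr_pwDl// mulr_ge0.
  rewrite -lnM ?posrE// ler_ln ?posrE ?mulr_gt0 ?ltr0n ?addn1//.
  rewrite -addn1 natrD natrM; have := ler_norm wu; have := normr_ge0 wu; nra.
have f2 : ln ((4 ^ L.+1) ^ 2)%N%:R <= 16 * y :> R.
  rewrite natrX natrX -exprM lnXn// -[leLHS]mulr_natl.
  have l4 : ln 4 <= 4 :> R by apply: ln_le_id.
  have l40 : 0 <= ln 4 :> R by rewrite ln_ge0// ler1n.
  rewrite natrM -natr1; have : 0 <= L%:R :> R by []. nra.
have r0 : 0 <= ln ((maxn S n)%:R / n%:R) :> R.
  by rewrite ln_ge0// ler_pdivlMr// mul1r ler_nat leq_maxr.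
have f3 : ln (maxn S n %/ n).+1%N%:R <= 2 * y + ln ((maxn S n)%:R / n%:R) :> R.
  have m0 : 0 < (maxn S n)%:R / n%:R :> R.
    by rewrite divr_gt0// ltr0n; apply: leq_trans n0 (leq_maxr _ _).
  apply: (@le_trans _ _ (ln (2 * ((maxn S n)%:R / n%:R)))).
    have m2 : 0 < 2 * ((maxn S n)%:R / n%:R) :> R by rewrite mulr_gt0.
    rewrite ler_ln ?posrE ?ltr0Sn// -natr1.
    have h1 : (maxn S n %/ n)%:R <= (maxn S n)%:R / n%:R :> R.
      by rewrite ler_pdivlMr// -natrM ler_nat leq_trunc_div.
    have h2 : 1 <= (maxn S n)%:R / n%:R :> R.
      by rewrite ler_pdivlMr// mul1r ler_nat leq_maxr.
    lra.
  rewrite lnM ?posrE// lerD2r; have := ln2_le1; lra.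
have f4 : ln (8 * slots n)%N%:R <= 57 * y :> R.
  have tl : (trunc_log 2 n)%:R <= 2 * l :> R.
    have : ln (2 ^ trunc_log 2 n)%:R <= l by rewrite ler_ln ?posrE ?ltr0n ?expn_gt0// ler_nat
      trunc_logP.
    rewrite natrX lnXn// -[X in X <= _]mulr_natl.
    have := ln2_ge; have : 0 <= (trunc_log 2 n)%:R :> R by []. nra.
  apply: (@le_trans _ _ (ln (56 * l))).
    have ld0 : 0 < (8 * slots n)%N%:R :> R by rewrite ltr0n /slots addnS.
    rewrite ler_ln ?posrE ?mulr_gt0//.
    rewrite /slots natrM natrD; lra.
  rewrite lnM ?posrE//; have : ln 56 <= 56 :> R by apply: ln_le_id.
  rewrite -/y; lra.
have ap : 0 < 1 + 3 * `|a| by rewrite ltr_pwDl// mulr_ge0.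
have kap1 : 1 <= kap by rewrite /kap lerDl mulr_ge0 ?mulr_ge0// exprn_ge0// ltW.
have lkap : ln kap <= ln (1 + 3 * `|a|) + b%:R * y.
  have lb : 1 <= l ^+ b by apply: exprn_ege1.
  apply: (@le_trans _ _ (ln ((1 + 3 * `|a|) * l ^+ b))).
    rewrite ler_ln ?posrE ?mulr_gt0 ?exprn_gt0//; last by apply: lt_le_trans kap1.
    by rewrite /kap [leRHS]mulrDl mul1r lerD2r.
  by rewrite lnM ?posrE ?exprn_gt0// lnXn// -[y *+ b]mulr_natl.
have tL : 1 <= 2 ^+ L :> R by apply: exprn_ege1; rewrite ler1n.
have f5 : ln (8 * separation L kap)%N%:R <= y * (28 + 2 * ln (1 + 3 * `|a|) + 2 * b%:R) :> R.
  set z := (2 ^+ L * kap) ^+ 2.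
  have z1 : 1 <= z.
    rewrite /z exprn_ege1//; apply: (le_trans kap1).
    by rewrite ler_peMl// (le_trans ler01 kap1).
  have z0 : 0 < z by apply: lt_le_trans z1.
  apply: (@le_trans _ _ (ln (24 * z))).
    have z2 : 0 < 24 * z by rewrite mulr_gt0.
    rewrite ler_ln ?posrE ?ltr0n//.
    rewrite /separation natrM -addn2 natrD -/z.
    have : (Num.truncn z)%:R <= z by rewrite truncn_le ltW.
    lra.
  have k0 : 0 < kap by apply: lt_le_trans kap1.
  rewrite lnM ?posrE// /z lnXn ?mulr_gt0 ?exprn_gt0// lnM ?posrE ?exprn_gt0// lnXn//.
  have : ln 24 <= 24 :> R by apply: ln_le_id.
  rewrite -[ln 2 *+ L]mulr_natl -[(_ + _) *+ 2]mulr_natl.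
  have := ln2_le1; have := ln2_ge; have : 0 <= L%:R :> R by [].
  have h2 : 0 <= ln (1 + 3 * `|a|) by rewrite ln_ge0// lerDl mulr_ge0.
  have h3 : 0 <= b%:R :> R by [].
  nra.
have sep0 : 0 < (8 * separation L kap)%N%:R :> R by rewrite ltr0n.
have ld0 : 0 < (8 * slots n)%N%:R :> R by rewrite ltr0n /slots addnS.
have -> : ln (arity_base n S w L kap)%:R = ln (2 * w + 1)%N%:R + ln ((4 ^ L.+1) ^ 2)%N%:R +
    ln (maxn S n %/ n).+1%N%:R + ln (8 * slots n)%N%:R + 2 ^+ L * ln (8 * separation L kap)%N%:R :>
      R.
  have w0 : 0 < (2 * w + 1)%N%:R :> R by rewrite ltr0n addn1.
  have q0 : 0 < ((4 ^ L.+1) ^ 2)%N%:R :> R by rewrite ltr0n !expn_gt0.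
  have m0 : 0 < (maxn S n %/ n).+1%N%:R :> R by rewrite ltr0n.
  have e5 : ln ((8 * separation L kap) ^ 2 ^ L)%N%:R = 2 ^+ L * ln (8 * separation L kap)%N%:R :> R.
    by rewrite natrX lnXn// -[LHS]mulr_natl natrX.
  have e0 : 0 < ((8 * separation L kap) ^ 2 ^ L)%N%:R :> R by rewrite natrX exprn_gt0.
  rewrite /arity_base 4!natrM -e5; move: w0 q0 m0 ld0 e0.
  move: ((8 * separation L kap) ^ 2 ^ L)%N%:R ((4 ^ L.+1) ^ 2)%N%:R (2 * w + 1)%N%:R (_.+1)%:R
    (8 * slots n)%N%:R => u1 u2 u3 u4 u5 p1 p2 p3 p4' p5.
  by rewrite !lnM ?posrE ?mulr_gt0.
have h1 : 0 <= ln (1 + 2 * `|wu|) by rewrite ln_ge0// lerDl mulr_ge0.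
have h2 : 0 <= ln (1 + 3 * `|a|) by rewrite ln_ge0// lerDl mulr_ge0.
have h3 : 0 <= b%:R :> R by [].
have f5' := ler_wpM2l (le_trans ler01 tL) f5.
rewrite /growth_const.
move: (ln (2 * w + 1)%N%:R) (ln ((4 ^ L.+1) ^ 2)%N%:R) (ln (maxn S n %/ n).+1%N%:R)
  (ln (8 * slots n)%N%:R)
  (2 ^+ L * ln _) (ln (1 + 2 * _)) (ln (1 + 3 * _)) (ln (_ / _)) f1 f2 f3 f4 f5' h1 h2 h3 r0 tL.
move=> x1 x2 x3 x4 x5 c1 c2 r f1 f2 f3 f4 f5' h1 h2 h3 r0 tL.
move: (2 ^+ L) (b%:R) tL f5' h3 => t bb tL f5' h3.
apply: (@le_trans _ _ (c1 + y + 16 * y + (2 * y + r) + 57 * y + t * (y * (28 + 2 * c2 + 2 * bb)))).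
  lra.
have ry : 0 <= r + y by lra.
have t1 : y <= t * y by rewrite ler_peMl//; lra.
apply: (@le_trans _ _ (t * (r + y) * (c1 + 77) + t * (r + y) * (28 + 2 * c2 + 2 * bb))).
  apply: lerD; last first.
    rewrite mulrA; apply: ler_wpM2r; first lra.
    by apply: ler_wpM2l; lra.
  apply: (@le_trans _ _ ((r + y) * (c1 + 77))); first nra.
  apply: ler_wpM2r; first lra.
  by rewrite ler_peMl.
lra.
Qed.

End Numerics.

(** * The number of levels and the final bound *)

Lemma size_exponent_lt L : ((L * 2 ^ L.+2).+1 < 5 * 4 ^ L)%N.
Proof.
have -> : (4 ^ L = 2 ^ L * 2 ^ L)%N by rewrite -expnMn.
by rewrite !expnS; have := ltn_expl L (isT : 1 < 2)%N; move: (2 ^ L)%N => p; nia.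
Qed.

Lemma pow8_split (R : realType) (x y : R) L :
  (5 * 4 ^ L)%N%:R * (2 ^+ L * x * y) = 8 ^+ L * (5 * y) * x.
Proof.
have -> : (8 : R) = 4 * 2 by ring.
rewrite natrM natrX exprMn; ring.
Qed.

(** With [X] the argument of the outer logarithm, [L] is the largest integer such that
    [8 ^+ L <= X / C2]. Then [ln X] is [O(L + 1)], and [probes_ge] forces [T] to grow linearly in
    [L]. *)
Lemma rand_lower_bound (R : realType) (eps M a : R) (b : nat) (wl wu : R) (delta : R) :
  0 < eps -> delta < 2^-1 ->
  exists (c : R) (N : nat), 0 < c /\
  forall (n sigma S w T : nat) (k : R),
    (N <= n)%N -> regime eps M a b wl wu n sigma k w ->
    forall (d : measure_display) (Omega : measurableType d)
      (P : probability Omega R)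
      (D : rand_ds {ffun 'I_n -> 'I_sigma} ('I_n * 'I_sigma) R Omega S w),
      rand_solves (@approx_ok R n sigma k) P delta D -> rand_time_le D T ->
      c * probe_bound R n sigma S <= T%:R.
Proof.
move=> eps0 d2.
pose C3 := growth_const a wu b; have C31 : 1 <= C3 := growth_const_ge1 a wu b.
pose C2 : R := 5 * C3; have C21 : 1 <= C2 by rewrite /C2; lra.
pose l8 : R := ln 8; pose l43 : R := ln (4 / 3).
have l81 : 1 <= l8.
  have -> : l8 = 3 * ln 2.
    have e8 : (8 : R) = 2 ^+ 3 by ring.
    by rewrite /l8 e8 lnXn// [RHS]mulr_natl.
  have := @ln2_ge R; lra.
have l430 : 0 < l43 by rewrite /l43 ln_gt0// ltr_pdivlMr//; lra.
(* Collects the final estimates [ln X <= ln C2 + (L + 1) * l8] and [L <= 4 / l43 * T], with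
   [T >= 1]. *)
pose cc := ln C2 + l8 + l8 * (4 / l43).
have lC2 : 0 <= ln C2 by apply: ln_ge0.
have q0 : 0 <= l8 * (4 / l43) by rewrite mulr_ge0 ?divr_ge0// ltW// (lt_le_trans _ l81).
have cc1 : 1 <= cc by rewrite /cc; lra.
(* The first threshold gives [ln (ln n) >= 1]; the second absorbs [M] into [n ^ eps], so that
   [sigma <= n]. *)
exists cc^-1, (maxn (Num.truncn (expR (expR 1) : R)) (Num.truncn ((`|M| + 1) `^ eps^-1))).+2.
split; first by rewrite invr_gt0; lra.
move=> n sigma S w T k nN [sM kl /andP[_ wl_]] d Omega P D sol tim.
have cc0 : 0 < cc by lra.
rewrite -[X in _ <= X]mulr1 mulrC ler_pdivrMr// mulr1 [leRHS]mulrC.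
have n2 : (1 < n)%N by apply: leq_trans nN.
have nR : 0 < n%:R :> R by rewrite ltr0n ltnW.
have nE : expR (expR 1) <= n%:R :> R.
  apply: ltW; apply: lt_le_trans (truncnS_gt _) _; rewrite ler_nat.
  by apply: leq_trans nN; rewrite ltnS ltnW// ltnS leq_maxl.
have nM : (`|M| + 1) `^ eps^-1 <= n%:R :> R.
  apply: ltW; apply: lt_le_trans (truncnS_gt _) _; rewrite ler_nat.
  by apply: leq_trans nN; rewrite ltnS ltnW// ltnS leq_maxr.
set l : R := ln n%:R; set y := ln l.
have l1 : expR 1 <= l by rewrite -[leLHS]expRK ler_ln ?posrE ?expR_gt0.
have l0 : 0 < l by apply: lt_le_trans l1; apply: expR_gt0.
have y1 : 1 <= y by rewrite -[leLHS]expRK ler_ln ?posrE ?expR_gt0.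
have sn : (sigma <= n)%N.
  rewrite -(ler_nat R); apply: (le_trans sM).
  have M1 : 0 < `|M| + 1 by rewrite ltr_wpDl.
  have Mn : M <= n%:R `^ eps.
    apply: (@le_trans _ _ (`|M| + 1)); first by apply: le_trans (ler_norm M) _; lra.
    have -> : `|M| + 1 = ((`|M| + 1) `^ eps^-1) `^ eps.
      by rewrite -powRrM mulVf ?lt0r_neq0// powRr1// ltW.
    by apply: ge0_ler_powR => //; rewrite ?nnegrE ?powR_ge0// ltW.
  apply: (@le_trans _ _ (n%:R `^ eps * n%:R `^ (1 - eps))).
    by apply: ler_wpM2r => //; apply: powR_ge0.
  rewrite -powRD; last by rewrite (gt_eqF nR) implybT.
  by rewrite (addrC eps) subrK powRr1// ltW.
set r : R := ln ((maxn S n)%:R / n%:R).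
have r0 : 0 <= r.
  by rewrite ln_ge0// ler_pdivlMr// mul1r ler_nat leq_maxr.
have A0 : 0 < r + y by lra.
rewrite /probe_bound -/l -/y -/r; set X := ln sigma%:R / (r + y).
have [X1|X1] := leP X 1.
  by apply: (@le_trans _ _ 0); [exact: ln_le0|rewrite mulr_ge0// ltW].
have s2 : (1 < sigma)%N.
  rewrite ltnNge; apply/negP => s1; move: X1; rewrite /X.
  have -> : ln sigma%:R = 0 :> R by case: sigma s1 {sM D sol tim sn X} => [|[|//]] _;
    [exact: ln0|exact: ln1].
  by rewrite mul0r ltr10.
have sR : 0 < sigma%:R :> R by rewrite ltr0n ltnW.
have fail : ~ rand_time_le D 0 by apply: zero_probes_fail sol.
(* Without cells every tree is an immediate answer. *)
have S0 : (0 < S)%N.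
  case: S D sol tim fail {r r0 A0 X X1} => [|//] D _ _; case=> om i q.
  by case: (rand_query D om q) => // -[].
have T0 : (0 < T)%N by case: T tim => // tim; case: fail.
have T1 : 1 <= T%:R :> R by rewrite ler1n.
have X0 : 0 < X by apply: lt_trans X1.
(* For bounded [X], a single probe meets the bound. *)
have [XC|XC] := leP X C2.
  apply: (@le_trans _ _ (ln C2)); first by rewrite ler_ln ?posrE//; lra.
  apply: (@le_trans _ _ cc); first by rewrite /cc; lra.
  by rewrite ler_peMr// ltW.
have C20 : 0 < C2 by lra.
pose z := ln (X / C2) / l8.
have XC0 : 0 < X / C2 by rewrite divr_gt0.
have z0 : 0 <= z.
  apply: divr_ge0; last exact: le_trans l81.
  by rewrite ln_ge0// ler_pdivlMr// mul1r ltW.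
pose L := Num.truncn z.
have /andP[Lz zL] := truncn_itv z0; rewrite -/L in Lz zL.
have l80 : 0 < l8 by lra.
have L8 : 8 ^+ L <= X / C2.
  rewrite -ler_ln ?posrE ?exprn_gt0// lnXn// -[X in X <= _]mulr_natl.
  by rewrite -ler_pdivlMr.
have Xl : X <= l.
  have ry1 : 1 <= r + y by apply: (le_trans y1); rewrite lerDr.
  rewrite /X (ler_pdivrMr _ _ A0); apply: (@le_trans _ _ l).
    by rewrite /l (ler_ln sR nR) ler_nat.
  by rewrite (ler_peMr (ltW l0) ry1).
have Ly : L%:R <= y.
  have : ln (8 ^+ L) <= y.
    rewrite ler_ln ?posrE ?exprn_gt0//; apply: (le_trans L8); apply: le_trans Xl.
    by rewrite ler_pdivrMr// ler_peMr// ltW.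
  rewrite lnXn// -[X in X <= _]mulr_natl -/l8; apply: le_trans.
  by rewrite ler_peMr ?ler0n.
pose kap : R := 1 + 3 * `|a| * l ^+ b.
have alb : 0 <= 3 * `|a| * l ^+ b by rewrite !mulr_ge0// exprn_ge0// ltW.
have kap1 : 1 <= kap by rewrite /kap lerDl.
have k3 : 3 * k <= kap.
  have : k <= `|a| * l ^+ b.
    by apply: (le_trans kl); apply: ler_wpM2r; rewrite ?ler_norm// exprn_ge0// ltW.
  move=> h; apply: (@le_trans _ _ (3 * (`|a| * l ^+ b))); first by rewrite ler_pM2l.
  by rewrite /kap mulrA lerDr.
(* The exponent is below [5 * 4 ^ L] and the logarithm of the base is at most
   [2 ^+ L * (r + y) * C3]. Their product is the origin of [8 ^+ L] and of [C2 = 5 * C3]. *)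
have big : (arity_base n S w L kap ^ (L * 2 ^ L.+2).+1 < sigma)%N.
  have b0 : 0 < (arity_base n S w L kap)%:R :> R.
    by rewrite ltr0n /arity_base !muln_gt0 !expn_gt0 /slots !addnS.
  rewrite -(ltr_nat R) -ltr_ln ?posrE ?natrX ?exprn_gt0// lnXn// -[X in X < _]mulr_natl.
  have lb := ln_arity_base_le a b S (ltnW n2) y1 wl_ Ly; rewrite -/l -/r -/y -/C3 in lb.
  have C30 : 0 < C3 := lt_le_trans ltr01 C31.
  have B0 : 0 < 2 ^+ L * (r + y) * C3 by rewrite !mulr_gt0 ?exprn_gt0.
  apply: (@le_lt_trans _ _ ((L * 2 ^ L.+2).+1%:R * (2 ^+ L * (r + y) * C3))).
    by apply: ler_wpM2l.
  apply: (@lt_le_trans _ _ ((5 * 4 ^ L)%N%:R * (2 ^+ L * (r + y) * C3))).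
    by rewrite (ltr_pM2r B0) ltr_nat size_exponent_lt.
  have -> : ln sigma%:R = X * (r + y) by rewrite /X divfK// gt_eqF.
  rewrite pow8_split -/C2.
  by apply: ler_wpM2r; [exact: ltW|rewrite -ler_pdivlMr].
have := probes_ge S0 kap1 k3 sn big sol tim.
move=> main.
(* Since [1 - delta > 1 / 2], subtracting the [1 / 4] of crowded colourings leaves more than
   [1 / 4]. *)
have {}main : 1 <= 2 ^+ T * 8 * (3 / 4) ^+ L :> R.
  move: main d2; clear; move: (2 ^+ T) ((3 / 4) ^+ L) => p q.
  rewrite (_ : p * 8 * q = 4 * (p * (2 * q))); last by ring.
  by move: (p * (2 * q)) => pq h d2; lra.
have Lmain : L%:R * l43 <= 4 * T%:R.
  have : ln ((4 / 3) ^+ L) <= ln (2 ^+ (T + 3)) :> R.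
    rewrite ler_ln ?posrE ?exprn_gt0 ?divr_gt0//.
    have e : (4 / 3) ^+ L * (3 / 4) ^+ L = 1 :> R.
      by rewrite -exprMn (_ : 4 / 3 * (3 / 4) = 1) ?expr1n//; field.
    have p0 : 0 < (3 / 4) ^+ L :> R by rewrite exprn_gt0// divr_gt0.
    rewrite -(ler_pM2r p0) e exprD; apply: (le_trans main).
    by have -> : (2 : R) ^+ 3 = 8 by ring.
  rewrite !lnXn ?divr_gt0// -/l43 -[X in X <= _]mulr_natl -[X in _ <= X]mulr_natl natrD.
  move=> h; apply: (le_trans h); apply: (@le_trans _ _ (T%:R + 3)).
    by rewrite ler_piMr ?ln2_le1.
  by move: T1; clear; lra.
have lnX : ln X <= ln C2 + (L%:R + 1) * l8.
  have : ln (X / C2) <= (L%:R + 1) * l8 by rewrite -ler_pdivrMr// natr1 ltW.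
  by rewrite lnM ?posrE ?invr_gt0// lnV ?posrE// lerBlDl.
apply: (le_trans lnX).
have : L%:R <= 4 / l43 * T%:R by rewrite mulrAC ler_pdivlMr.
move=> h; have := ler_wpM2l (ltW l80) h.
have h3 : ln C2 <= ln C2 * T%:R by rewrite ler_peMr.
have h4 : l8 <= l8 * T%:R by rewrite ler_peMr// ltW.
rewrite /cc => h2; move: h2 h3 h4; clear.
move: (ln C2) (4 / l43) (L%:R : R) (T%:R : R) => p q i t; clearbody l8; lra.
Qed.

Unset Implicit Arguments.

Theorem theorem5 (R : realType) (eps M a : R) (b : nat) (wl wu : R)
    (eps_gt0 : 0 < eps) (wl_gt0 : 0 < wl) :
  (exists (c : R) (N : nat), 0 < c /\
    forall (n sigma S w T : nat) (k : R),
      (N <= n)%N -> regime eps M a b wl wu n sigma k w ->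
      forall D : det_ds {ffun 'I_n -> 'I_sigma} ('I_n * 'I_sigma) R S w,
        det_solves (@approx_ok R n sigma k) D -> det_time_le D T ->
        c * probe_bound R n sigma S <= T%:R)
  /\
  (forall delta : R, 0 <= delta -> delta < 2^-1 ->
    exists (c : R) (N : nat), 0 < c /\
    forall (n sigma S w T : nat) (k : R),
      (N <= n)%N -> regime eps M a b wl wu n sigma k w ->
      forall (d : measure_display) (Omega : measurableType d)
        (P : probability Omega R)
        (D : rand_ds {ffun 'I_n -> 'I_sigma} ('I_n * 'I_sigma) R Omega S w),
        rand_solves (@approx_ok R n sigma k) P delta D -> rand_time_le D T ->
        c * probe_bound R n sigma S <= T%:R).
Proof.
have h2 : (0 : R) < 2^-1 by rewrite invr_gt0.
split=> [|delta _ d2]; last exact: rand_lower_bound.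
have [c [N [c0 lb]]] := rand_lower_bound M a b wl wu eps_gt0 h2.
exists c, N; split=> // n sigma S w T k nN reg D sol tim.
apply: (lb n sigma S w T k nN reg _ _ _ _ (det_solves_rand R sol)) => om i q.
exact: tim.
Qed.
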